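(* Let $\ell>0$ and $\nu(z)=e^{\ell(z+z^{-1})/2}$ on $\mathbb T$ (in which case the coefficients $\alpha_n$ are real). Then for every $n\in\mathbb N$ the matrix function $\widetilde M_n(z)=z^2M_n(z)$ is $$\widetilde M_n(z)=\begin{bmatrix}\frac{\ell}{4}z^2+\frac n2z+\frac{\ell}{4}\big(b_{n-1}b_n^{-1}-\alpha_{n-1}^2\big)&-\frac{\ell}{2}b_n^{-1}(\alpha_{n-1}-\alpha_nz)\\[4pt]-\frac{\ell}{2}b_{n-1}(\alpha_{n-1}-\alpha_{n-2}z)&-\frac{\ell}{4}z^2-\frac n2z-\frac{\ell}{4}\big(b_{n-1}b_n^{-1}-\alpha_{n-1}^2\big)\end{bmatrix}.$$
   Context: $\mathbb N=\{1,2,\dots\}$, $\mathbb T=\{|z|=1\}$ (counterclockwise), $d\mu(z)=\frac{\nu(z)}{\mathrm i z}dz$. $\Phi_n$ is the monic polynomial of degree $n$ with $\int_{\mathbb T}\Phi_n\overline{\Phi_m}\,d\mu=\kappa_n^{-2}\delta_{n,m}$, $\kappa_n>0$; $\Phi_n^*(z)=z^n\overline{\Phi_n(1/\bar z)}$; $\alpha_{n-1}=-\overline{\Phi_n(0)}$ for $n\ge1$ and $\alpha_{-1}=-1$; $b_n=2\pi\kappa_n^2$. For $z\notin\mathbb T$, $$G_n(z)=\frac1{2\pi \mathrm i}\int_{\mathbb T}\frac{\Phi_n(t)}{t-z}\frac{\nu(t)}{t^n}dt,\quad G_{n-1}^*(z)=\frac1{2\pi \mathrm i}\int_{\mathbb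 T}\frac{\Phi_{n-1}^*(t)}{t-z}\frac{\nu(t)}{t^n}dt,\quad Y_n=\begin{bmatrix}\Phi_n&G_n\\-b_{n-1}\Phi_{n-1}^*&-b_{n-1}G_{n-1}^*\end{bmatrix}\quad(n\in\mathbb N).$$ $C_n(z)=\operatorname{diag}\big(z^{-n/2}\nu(z)^{1/2},\,z^{n/2}\nu(z)^{-1/2}\big)$, $Z_n=Y_nC_n$, $M_n=Z_n'Z_n^{-1}=Y_n'Y_n^{-1}+Y_nC_n'C_n^{-1}Y_n^{-1}$ (independent of the local branches chosen in $C_n$, since $C_n'C_n^{-1}=\big(-\frac n{2z}+\frac{\nu'(z)}{2\nu(z)}\big)\operatorname{diag}(1,-1)$). *)

(* Defs.v *)
From HB Require Import structures.
From mathcomp Require Import all_boot all_order all_algebra.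
From mathcomp Require Import all_classical all_reals all_analysis.
From mathcomp.real_closed Require Import complex.

Set Implicit Arguments.
Unset Strict Implicit.
Unset Printing Implicit Defensive.

Import Order.TTheory GRing.Theory Num.Theory.
Import numFieldNormedType.Exports.

Local Open Scope classical_set_scope.
Local Open Scope ring_scope.
Local Open Scope complex_scope.

(* Topology and norm of the complex plane, so that [derive1] on functions of
   R[i] is the complex derivative. *)
HB.instance Definition _ (R : realType) := NormedModule.copy R[i] R[i]^o.

Section Definitions.
Context {R : realType}.
Local Notation C := R[i].

Definition cis (t : R) : C := cos t +i* sin t.

Definition cexp (z : C) : C := (expR (complex.Re z))%:C * cis (complex.Im z).

(* Contour integral over the counterclockwise unit circle, parametrised by
   t |-> e^{it}, with dz = i e^{it} dt. *)
Definition circle_integral (f : C -> C) : C :=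
  let g t := f (cis t) * ('i * cis t) in
  (\int[lebesgue_measure]_(t in `[0, 2 * pi]) complex.Re (g t))
  +i* (\int[lebesgue_measure]_(t in `[0, 2 * pi]) complex.Im (g t)).

Definition mu_integral (nu f : C -> C) : C :=
  circle_integral (fun z => f z * (nu z / ('i * z))).

Definition is_monic_OPUC (nu : C -> C) (Phi : nat -> {poly C})
    (kappa : nat -> R) : Prop :=
  [/\ forall n, Phi n \is monic /\ size (Phi n) = n.+1,
      forall n, 0 < kappa n
    & forall n m, mu_integral nu (fun z => (Phi n).[z] * ((Phi m).[z])^* )
                  = (kappa n ^- 2)%:C *+ (n == m)].

(* Since inversion is total, this is the paper's Phi_n^* only for z != 0; its
   value at 0 is never used below. *)
Definition reversed (Phi : nat -> {poly C}) (n : nat) (z : C) : C :=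
  z ^+ n * ((Phi n).[(z^* )^-1])^*.

(* alpha_k for k >= -1: alpha_{n-1} = - conj (Phi_n(0)) for n >= 1, and
   alpha_{-1} = -1.  The value at k < -1 is irrelevant. *)
Definition verblunsky (Phi : nat -> {poly C}) (k : int) : C :=
  match k with
  | Posz j => - ((Phi j.+1).[0])^*
  | Negz _ => -1
  end.

Definition bcoef (kappa : nat -> R) (n : nat) : C :=
  (2 * pi * kappa n ^+ 2)%:C.

Definition Gfun (nu : C -> C) (Phi : nat -> {poly C}) (n : nat) (z : C) : C :=
  (2 * pi%:C * 'i)^-1 *
  circle_integral (fun t => (Phi n).[t] / (t - z) * (nu t / t ^+ n)).

(* The power of t is one more than the index: G_{n-1}^* has t^n. *)
Definition Gstar (nu : C -> C) (Phi : nat -> {poly C}) (k : nat) (z : C) : C :=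
  (2 * pi%:C * 'i)^-1 *
  circle_integral (fun t => reversed Phi k t / (t - z) * (nu t / t ^+ k.+1)).

Definition mx2 (a b c d : C) : 'M[C]_2 :=
  \matrix_(i, j) (if i == 0 then (if j == 0 then a else b)
                            else (if j == 0 then c else d)).

(* Only meant for n >= 1, because of n.-1. *)
Definition Ymx (nu : C -> C) (Phi : nat -> {poly C}) (kappa : nat -> R)
    (n : nat) (z : C) : 'M[C]_2 :=
  mx2 (Phi n).[z] (Gfun nu Phi n z)
      (- bcoef kappa n.-1 * reversed Phi n.-1 z)
      (- bcoef kappa n.-1 * Gstar nu Phi n.-1 z).

Definition sqrt_branch_near (f : C -> C) (z : C) (r : C -> C) : Prop :=
  \forall w \near z, {for w, continuous r} /\ r w ^+ 2 = f w.

(* r and s stand for local branches of z^{1/2} and nu(z)^{1/2}. *)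
Definition Cmx (r s : C -> C) (n : nat) (z : C) : 'M[C]_2 :=
  mx2 (r z ^- n * s z) 0
      0 (r z ^+ n * (s z)^-1).

Definition Zmx (nu : C -> C) (Phi : nat -> {poly C}) (kappa : nat -> R)
    (r s : C -> C) (n : nat) (z : C) : 'M[C]_2 :=
  Ymx nu Phi kappa n z *m Cmx r s n z.

Definition Mmx (nu : C -> C) (Phi : nat -> {poly C}) (kappa : nat -> R)
    (r s : C -> C) (n : nat) (z : C) : 'M[C]_2 :=
  derive1 (Zmx nu Phi kappa r s n) z *m invmx (Zmx nu Phi kappa r s n z).

(* The weight e^{l (z + 1/z) / 2}, on all of C \ {0}. *)
Definition exp_weight (l : R) (z : C) : C :=
  cexp (l%:C * (z + z^-1) / 2).

End Definitions.

(* Main.v *)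
Require Import Defs.
From HB Require Import structures.
From mathcomp Require Import all_boot all_order all_algebra.
From mathcomp Require Import all_classical all_reals all_analysis.
From mathcomp.real_closed Require Import complex.
From mathcomp Require Import ring zify.

Set Implicit Arguments.
Unset Strict Implicit.
Unset Printing Implicit Defensive.

Import Order.TTheory GRing.Theory Num.Theory.
Import numFieldNormedType.Exports.

Local Open Scope classical_set_scope.
Local Open Scope ring_scope.
Local Open Scope complex_scope.

(** On Laurent polynomials, integration against [nu dtheta] is a Toeplitz form
    [B (p, q)], and integrating a derivative around the circle gives the Pearson
    equation [B (z p', q) - B (p, z q') + l/2 (B (z p, q) - B (p, z q)) = 0].
    This equation forces the form to be symmetric, hence the [Phi_n] to be
    real; orthogonality then yields the Szego recursion and first-order
    differential equations for [Phi_n] and [Phi_(n-1)^*], that is, for the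
    first column of [Y_n].  Integrating by parts in the Cauchy
    transform transfers these equations to the second column.  The Szego
    recursion also makes [det Y_n] independent of [n].  The formula for
    [z^2 M_n] then only collects the four scalar equations. *)

(** * Orthogonal polynomials for a Toeplitz form with a Pearson equation *)

(** The form is bilinear: [B p q] integrates p(z) q(1/z) and leaves the coefficients unconjugated,
    so the algebra can be done over any field. The given orthogonality, however, is Hermitian. It
    passes to [B] because the conjugates of the [Phi m] again supply one monic polynomial in each
    degree; symmetry of [B] then shows that conjugation fixes [Phi n]. The recursion for [Phi n] and
    the two derivative formulas share one argument: the difference of the two sides has low degree
    and is orthogonal to every polynomial of that degree, hence vanishes. The factor [1 - al ^+ 2]
    in the equations is the ratio of consecutive norms, which is the b_(n-1) / b_n of the final
    formula. *)

Lemma functional_poly_sum (F : fieldType) (f : {poly F} -> F) (n : nat)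
    (p : {poly F}) :
  (forall c p q, f (c%:P * p + q) = c * f p + f q) -> (size p <= n)%N ->
  f p = \sum_(i < n) p`_i * f 'X^i.
Proof.
move=> flin sp.
have f0 : f 0 = 0.
  by have := flin (-1) 0 0; rewrite mulr0 addr0 mulN1r addNr.
have -> : p = \sum_(i < n) (p`_i)%:P * 'X^i.
  apply/polyP=> k; rewrite coef_sum.
  under eq_bigr do rewrite coefCM coefXn.
  have [kn|nk] := ltnP k n; last first.
    rewrite nth_default ?(leq_trans sp)// big1// => i _.
    by rewrite gtn_eqF ?mulr0// (leq_trans (ltn_ord i)).
  rewrite (bigD1 (Ordinal kn))//= eqxx mulr1 big1 ?addr0// => i ik.
  by rewrite (_ : k == i = false) ?mulr0//; apply: contraNF ik => /eqP ki; apply/eqP/val_inj.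
(* Rewriting [p] as a sum also hit the coefficients on the right-hand side; [co] restores them. *)
have co i : (i < n)%N -> (\sum_(i < n) (p`_i)%:P * 'X^i)`_i = p`_i.
  move=> kn; rewrite coef_sum (bigD1 (Ordinal kn))//= coefCM coefXn eqxx mulr1.
  rewrite big1 ?addr0// => j jk; rewrite coefCM coefXn.
  by rewrite (_ : i == j = false) ?mulr0//; apply: contraNF jk => /eqP ki; apply/eqP/val_inj.
under [RHS]eq_bigr do rewrite co ?ltn_ord//.
elim/big_rec2: _ => [//|i u v _ <-].
by rewrite flin.
Qed.

Section PearsonForm.
Variables (F : fieldType) (a : F) (B : {poly F} -> {poly F} -> F).
Hypothesis BlinL : forall c p q r, B (c%:P * p + q) r = c * B p r + B q r.
Hypothesis BlinR : forall c p q r, B r (c%:P * p + q) = c * B r p + B r q.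
Hypothesis Bshift : forall p q, B ('X * p) ('X * q) = B p q.

Lemma bform0l r : B 0 r = 0.
Proof. by have := BlinL (-1) 0 0 r; rewrite mulr0 addr0 mulN1r addNr. Qed.
Lemma bform0r r : B r 0 = 0.
Proof. by have := BlinR (-1) 0 0 r; rewrite mulr0 addr0 mulN1r addNr. Qed.
Lemma bformDl p q r : B (p + q) r = B p r + B q r.
Proof. by have := BlinL 1 p q r; rewrite !mul1r. Qed.
Lemma bformDr p q r : B r (p + q) = B r p + B r q.
Proof. by have := BlinR 1 p q r; rewrite !mul1r. Qed.
Lemma bformZl c p r : B (c%:P * p) r = c * B p r.
Proof. by have := BlinL c p 0 r; rewrite !addr0 bform0l addr0. Qed.
Lemma bformZr c p r : B r (c%:P * p) = c * B r p.
Proof. by have := BlinR c p 0 r; rewrite !addr0 bform0r addr0. Qed.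
Lemma bformNl p r : B (- p) r = - B p r.
Proof. by have := bformZl (-1) p r; rewrite polyCN !mulN1r. Qed.
Lemma bformNr p r : B r (- p) = - B r p.
Proof. by have := bformZr (-1) p r; rewrite polyCN !mulN1r. Qed.

Definition bformE :=
  (bformDl, bformDr, bformNl, bformNr, bformZl, bformZr, bform0l, bform0r).

Lemma bform_XnXn i j k : B 'X^(i + k) 'X^(j + k) = B 'X^i 'X^j.
Proof.
elim: k => [|k IHk]; first by rewrite !addn0.
by rewrite !addnS !exprS Bshift.
Qed.

(** The hypothesis says i - j = k - l without truncated subtraction. Shifting the first pair by [l]
    and the second by [j] makes them equal. *)
Lemma bform_toeplitz i j k l :
  (i + l = k + j)%N -> B 'X^i 'X^j = B 'X^k 'X^l.
Proof.
by move=> e; rewrite -(bform_XnXn i j l) -(bform_XnXn k l j) e (addnC j).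
Qed.

Lemma bform_sym :
  a != 0 ->
  (forall p q, B ('X * p^`()) q - B p ('X * q^`())
     + a * (B ('X * p) q - B p ('X * q)) = 0) ->
  forall p q, B p q = B q p.
Proof.
move=> a0 pearson.
(* The Pearson equation is a three-term recurrence for the antisymmetric part
   of the moments; its first instance kills the first moment. *)
have symX1 k : B 'X^k 1 = B 1 'X^k /\ B 'X^(k.+1) 1 = B 1 'X^(k.+1).
  elim: k => [|k [IH1 IH2]].
    split=> //; have := pearson 1 1.
    rewrite -[1 : {poly F}]/(1%:P) derivC mulr0 bform0l bform0r subrr add0r mulr1 !expr1.
    by move/eqP; rewrite mulf_eq0 (negPf a0) subr_eq0 => /eqP.
  split=> //.
  have XD : ('X * ('X^(k.+1))^`() : {poly F}) = k.+1%:R%:P * 'X^(k.+1).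
    by rewrite derivXn /= mulrnAr -exprS rmorph_nat mulr_natl.
  have dist (x y : F) : a * (x - y) = 0 -> x = y.
    by move/eqP; rewrite mulf_eq0 (negPf a0) subr_eq0 => /eqP.
  have X1 j : B 'X ('X^(j.+1)) = B 1 'X^j.
    by rewrite exprS -[X in B X _]mulr1 Bshift.
  have X2 j : B ('X^(j.+1)) 'X = B 'X^j 1.
    by rewrite exprS -[X in B _ X]mulr1 Bshift.
  have := pearson 'X^(k.+1) 1.
  have := pearson 1 'X^(k.+1).
  rewrite -[1 : {poly F}]/(1%:P) derivC mulr0 XD !bformE !mulr1 !subr0 -!exprS X1 X2 => e1 e2.
  (* With c_j = B(X^j, 1) - B(1, X^j), the sum of [e1] and [e2] reads (k+1) c_(k+1) + a (c_(k+2) -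
     c_k) = 0, and c_k, c_(k+1) vanish by induction. *)
  apply: dist.
  rewrite -[1]/(1%:P) in IH1 IH2.
  rewrite IH2 in e2; rewrite IH1 in e2.
  have := congr2 +%R e2 e1; rewrite addr0 => <-; ring.
have symXX i j : B 'X^i 'X^j = B 'X^j 'X^i.
  have [ij|/ltnW ji] := leqP i j.
    by have := bform_XnXn 0 (j - i) i; have := bform_XnXn (j - i) 0 i;
      rewrite subnK// !add0n expr0 => -> ->; rewrite (symX1 _).1.
  by have := bform_XnXn 0 (i - j) j; have := bform_XnXn (i - j) 0 j;
    rewrite subnK// !add0n expr0 => -> ->; rewrite (symX1 _).1.
move=> p q.
have lin1 (r : {poly F}) c u v : B (c%:P * u + v) r = c * B u r + B v r by rewrite BlinL.
have lin2 (r : {poly F}) c u v : B r (c%:P * u + v) = c * B r u + B r v by rewrite BlinR.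
rewrite (functional_poly_sum (lin1 q) (leqnn (size p))).
rewrite (functional_poly_sum (lin2 q) (leqnn (size p))).
apply: eq_bigr => i _; congr (_ * _).
rewrite (functional_poly_sum (lin2 'X^i) (leqnn (size q))).
rewrite (functional_poly_sum (lin1 'X^i) (leqnn (size q))).
by apply: eq_bigr => j _; rewrite symXX.
Qed.

(** * Szego recursion and differential equations of the orthogonal polynomials *)

Section Orthogonal.
Hypothesis Bsym : forall p q, B p q = B q p.
Variables (Phi : nat -> {poly F}) (h : nat -> F).
Hypothesis Phi_monic : forall n, Phi n \is monic.
Hypothesis Phi_size : forall n, size (Phi n) = n.+1.
Hypothesis h_neq0 : forall n, h n != 0.
(** Allowing degree [n] itself records orthogonality to lower degrees and the norm [h n] in one
    identity. *)
Hypothesis Phi_orth : forall n (q : {poly F}), (size q <= n.+1)%N -> B (Phi n) q = q`_n * h n.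

(** Pairing [g] with [Phi m], where [m] is the degree of [g], gives the leading coefficient of [g]
    times [h m]. *)
Lemma bform_nondeg n (g : {poly F}) : (size g <= n)%N ->
  (forall q : {poly F}, (size q <= n)%N -> B g q = 0) -> g = 0.
Proof.
move=> sg Bg; apply/eqP; rewrite -size_poly_eq0.
case E : (size g) => [//|m].
have := Bg (Phi m); rewrite Phi_size -E => /(_ sg).
rewrite Bsym Phi_orth ?E// => /eqP; rewrite mulf_eq0 (negPf (h_neq0 m)) orbF.
have -> : g`_m = lead_coef g by rewrite lead_coefE E.
by rewrite lead_coef_eq0 => /eqP g0; rewrite g0 size_poly0 in E.
Qed.

Lemma Phi_unique n (p : {poly F}) : p \is monic -> size p = n.+1 ->
  (forall q : {poly F}, (size q <= n)%N -> B p q = 0) -> p = Phi n.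
Proof.
move=> pm sp Bp; apply/eqP; rewrite -subr_eq0; apply/eqP.
apply: (@bform_nondeg n).
  apply/leq_sizeP => j; rewrite leq_eqVlt => /predU1P[<-|nj].
    have := monicP pm; have := monicP (Phi_monic n).
    by rewrite !lead_coefE sp Phi_size coefB /= => -> ->; rewrite subrr.
  by rewrite coefB !nth_default ?subrr// ?sp ?Phi_size.
move=> q sq; rewrite !bformE Bp// Phi_orth ?(leq_trans sq)//.
by rewrite nth_default// mul0r subrr.
Qed.

(* With the shifted index, [al k] is the Verblunsky coefficient alpha_{k-1},
   and [al 0 = -1] because [Phi 0 = 1].  [Psi n] is Phi_n^* when the
   coefficients are real. *)
Definition al k := - (Phi k)`_0.
Definition Psi n := \poly_(i < n.+1) (Phi n)`_(n - i).

Lemma coef_Psi n i : (Psi n)`_i = if (i < n.+1)%N then (Phi n)`_(n - i) else 0.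
Proof. by rewrite coef_poly. Qed.

Lemma size_Psi n : (size (Psi n) <= n.+1)%N.
Proof. exact: size_poly. Qed.

Lemma Phi_lead n : (Phi n)`_n = 1.
Proof. by have := monicP (Phi_monic n); rewrite lead_coefE Phi_size. Qed.

Lemma Phi0 : Phi 0 = 1.
Proof.
have /size1_polyC -> : (size (Phi 0) <= 1)%N by rewrite Phi_size.
by rewrite Phi_lead.
Qed.

Lemma Psi0 : Psi 0 = 1.
Proof.
have /size1_polyC -> := size_Psi 0.
by rewrite coef_Psi /= Phi_lead.
Qed.

Lemma al0 : al 0 = -1.
Proof. by rewrite /al Phi_lead. Qed.

(** Reversal reflects exponents about [n], so the Toeplitz property and symmetry turn the pairing
    with ['X^j] into that of [Phi n] with ['X^(n - j)]. Only j = 0 survives. *)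
Lemma Psi_orth n (q : {poly F}) : (size q <= n.+1)%N -> B (Psi n) q = q`_0 * h n.
Proof.
move=> sq.
have Xn j : (j <= n)%N -> B (Psi n) 'X^j = (j == 0%N)%:R * h n.
  move=> jn.
  have -> : B (Psi n) 'X^j = B (Phi n) 'X^(n - j); last first.
    rewrite Phi_orth; last by rewrite size_polyXn ltnS leq_subr.
    rewrite coefXn; congr (_%:R * _); lia.
  have linL c u v : B (c%:P * u + v) 'X^j = c * B u 'X^j + B v 'X^j.
    by rewrite BlinL.
  rewrite (functional_poly_sum linL (size_Psi n)).
  have linR c u v : B (c%:P * u + v) 'X^(n - j) = c * B u 'X^(n - j) + B v 'X^(n-j).
    by rewrite BlinL.
  have sP : (size (Phi n) <= n.+1)%N by rewrite Phi_size.
  rewrite (functional_poly_sum linR sP).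
  rewrite (reindex_inj rev_ord_inj) /=; apply: eq_bigr => i _.
  rewrite coef_Psi subSS ltnS leq_subr subKn ?(leq_ord i)//; congr (_ * _).
  rewrite [RHS]Bsym.
  by apply: bform_toeplitz; have := leq_ord i; lia.
have linR c u v : B (Psi n) (c%:P * u + v) = c * B (Psi n) u + B (Psi n) v.
  by rewrite BlinR.
rewrite (functional_poly_sum linR sq) big_ord_recl big1 => [|i _].
  by rewrite addr0 Xn// mul1r.
by rewrite Xn ?ltn_ord//= mul0r mulr0.
Qed.

Lemma size_mulX (p : {poly F}) n : (size p <= n)%N -> (size ('X * p)%R <= n.+1)%N.
Proof. by move=> ?; rewrite (leq_trans (size_polyMleq _ _))// size_polyX. Qed.

(** In the difference [f] the leading terms cancel and [al n.+1] is what kills the constant term, so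
    [f] is ['X] times some g of degree below [n]. Since B(g, q) = B(f, X q), each of the three terms
    of [f] pairs to zero. *)
Lemma szego n : Phi n.+1 = 'X * Phi n - (al n.+1)%:P * Psi n.
Proof.
set f := 'X * Phi n - Phi n.+1 - (al n.+1)%:P * Psi n.
suff : f = 0 by rewrite /f => /eqP; rewrite subr_eq0 => /eqP <-; ring.
have f0 : f`_0 = 0.
  rewrite /f !coefB coefXM coefCM /= coef_Psi /= subn0 Phi_lead /al; ring.
have fn : (size f <= n.+1)%N.
  apply/leq_sizeP => j nj; rewrite /f !coefB coefXM coefCM coef_Psi.
  case: j nj => [//|j]; rewrite ltnS => nj /=.
  rewrite ltnS ltnNge nj /= mulr0 subr0.
  move: nj; rewrite leq_eqVlt => /predU1P[<-|nj].
    by rewrite !Phi_lead subrr.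
  by rewrite !nth_default ?subrr// ?Phi_size.
have fE : f = 'X * \poly_(i < n) f`_i.+1.
  apply/polyP => -[|i]; rewrite coefXM //= coef_poly.
  case: ltnP => // ni; rewrite nth_default// (leq_trans fn)//.
rewrite fE.
suff -> : \poly_(i < n) f`_i.+1 = 0 by rewrite mulr0.
apply: (@bform_nondeg n); first exact: size_poly.
move=> q sq; rewrite -Bshift -fE /f !bformE Bshift.
have sXq : (size ('X * q)%R <= n.+1)%N by apply: size_mulX.
rewrite !Phi_orth ?Psi_orth ?(leq_trans sXq)// ?(leq_trans sq)//.
rewrite !coefXM /= nth_default//; ring.
Qed.

Lemma szego_rev n : Psi n.+1 = Psi n - (al n.+1)%:P * ('X * Phi n).
Proof.
apply/polyP => i; rewrite coefB coefCM coefXM !coef_Psi szego.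
have [in1|in1] := ltnP i n.+2; last first.
  rewrite ltnNge (ltnW in1) /=; case: i in1 => [//|i] /= in1.
  by rewrite nth_default ?Phi_size// mulr0 subrr.
rewrite coefB coefXM coefCM coef_Psi.
have [->|i0] := eqVneq i 0%N; first by rewrite !subn0 /= ltnn !mulr0.
have -> : (n.+1 - i < n.+1)%N by lia.
have -> : (n - (n.+1 - i) = i.-1)%N by lia.
have [ni|ni] := ltnP i n.+1.
  have -> : (n.+1 - i == 0)%N = false by lia.
  by have -> : ((n.+1 - i).-1 = n - i)%N by lia.
by have -> : (n.+1 - i == 0)%N by lia.
Qed.

(** Two evaluations of [B (Phi n.+1) ('X * Phi n)]: the second argument is monic of degree [n.+1],
    and the first can be expanded by [szego]. *)
Lemma norm_succ n : h n.+1 = (1 - al n.+1 ^+ 2) * h n.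
Proof.
have E : B ('X * Phi n) (Psi n) = al n.+1 * h n.
  have -> : 'X * Phi n = Phi n.+1 + (al n.+1)%:P * Psi n by rewrite szego; ring.
  rewrite !bformE Phi_orth ?(leq_trans (size_Psi n))//.
  rewrite Psi_orth ?size_Psi// nth_default ?size_Psi// coef_Psi /= subn0 Phi_lead; ring.
transitivity (B (Phi n.+1) ('X * Phi n)).
  rewrite Phi_orth ?size_mulX ?Phi_size// coefXM /= Phi_lead; ring.
rewrite {1}szego !bformE Bshift (Bsym (Psi n)) E Phi_orth ?Phi_size// Phi_lead; ring.
Qed.

(** [PsiM] and [PhiM] solve the two recursions for [Psi n] and ['X * Phi n]; the multiplier is the
    determinant of that linear system. *)
Lemma PsiM n : (1 - al n.+1 ^+ 2)%:P * Psi n = Psi n.+1 + (al n.+1)%:P * Phi n.+1.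
Proof. rewrite szego_rev szego polyCB polyC1 polyC_exp; ring. Qed.

Lemma PhiM n :
  (1 - al n.+1 ^+ 2)%:P * ('X * Phi n) = Phi n.+1 + (al n.+1)%:P * Psi n.+1.
Proof. rewrite szego_rev szego polyCB polyC1 polyC_exp; ring. Qed.

Lemma size_Xderiv (p : {poly F}) n : (size p <= n)%N -> (size ('X * p^`())%R <= n)%N.
Proof.
move=> sp; apply/leq_sizeP => -[|j] nj; rewrite coefXM//=.
by rewrite coef_deriv nth_default ?mul0rn// (leq_trans sp).
Qed.

Lemma coef_Xderiv (p : {poly F}) n : ('X * p^`())`_n = n%:R * p`_n.
Proof.
by case: n => [|n]; rewrite coefXM /= ?mul0r// coef_deriv mulr_natl.
Qed.

Hypothesis pearson : forall p q, B ('X * p^`()) q - B p ('X * q^`())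
     + a * (B ('X * p) q - B p ('X * q)) = 0.

(** Leading terms cancel, so testing against [q] of degree at most [m] suffices. The Pearson
    equation then leaves a h_(m+1) (q_m - al_(m+2) q_0), and the coefficients q_m and q_0 are what
    [Phi m] and [Psi m] detect, at the cost of h_(m+1) / h_m. *)
Lemma PhiXderiv m : 'X * (Phi m.+1)^`() = m.+1%:R%:P * Phi m.+1
  + (a * (1 - al m.+1 ^+ 2))%:P * (Phi m - (al m.+2)%:P * Psi m).
Proof.
apply/eqP; rewrite -subr_eq0; apply/eqP.
apply: (@bform_nondeg m.+1).
  apply/leq_sizeP => j mj; rewrite coefB coefD !coefCM coefB coefCM coef_Xderiv.
  rewrite (nth_default _ (_ : (size (Phi m) <= j)%N)) ?Phi_size//.
  rewrite (nth_default _ (leq_trans (size_Psi m) mj)).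
  move: mj; rewrite leq_eqVlt => /predU1P[<-|mj]; first by ring.
  rewrite (nth_default _ (_ : (size (Phi m.+1) <= j)%N)) ?Phi_size//; ring.
move=> q sq; have sq2 := leqW sq; have sq3 := leqW sq2.
have := pearson (Phi m.+1) q.
have -> : B ('X * Phi m.+1) q = al m.+2 * (q`_0 * h m.+1).
  have -> : 'X * Phi m.+1 = Phi m.+2 + (al m.+2)%:P * Psi m.+1.
    by rewrite [Phi m.+2]szego; ring.
  rewrite !bformE Phi_orth// Psi_orth// nth_default//; ring.
rewrite !bformE !Phi_orth ?Psi_orth ?size_Xderiv ?size_mulX//.
rewrite coef_Xderiv coefXM /= (nth_default _ sq) norm_succ => e.
rewrite -[RHS]e; ring.
Qed.

(** One more factor ['X] lets [szego] eliminate [Phi m], so that only the first column of Y_n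
    occurs: [Phi m.+1] and [Psi m]. *)
Lemma Phi_ode m : 'X^2 * (Phi m.+1)^`() =
  (m.+1%:R%:P * 'X + (a * (1 - al m.+1 ^+ 2))%:P) * Phi m.+1
  + (a * (1 - al m.+1 ^+ 2))%:P
    * ((al m.+1)%:P - (al m.+2)%:P * 'X) * Psi m.
Proof.
rewrite expr2 -mulrA PhiXderiv.
have E : 'X * Phi m = Phi m.+1 + (al m.+1)%:P * Psi m by rewrite szego; ring.
transitivity (m.+1%:R%:P * 'X * Phi m.+1 + (a * (1 - al m.+1 ^+ 2))%:P
   * ('X * Phi m - (al m.+2)%:P * 'X * Psi m)); first by ring.
rewrite E; ring.
Qed.

Lemma size_sub_leq (p q : {poly F}) n :
  (size p <= n)%N -> (size q <= n)%N -> (size (p - q)%R <= n)%N.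
Proof.
by move=> sp sq; rewrite (leq_trans (size_polyD _ _))// size_polyN geq_max sp.
Qed.

Lemma size_cmul (p : {poly F}) c n : (size p <= n)%N -> (size (c%:P * p)%R <= n)%N.
Proof. by move=> sp; rewrite mul_polyC (leq_trans (size_scale_leq _ _)). Qed.

(** Shift invariance puts a factor ['X] on both arguments, so the Pearson equation applies with
    second argument ['X * q]. Its term with the derivative of ['X * q] drops out, having no constant
    coefficient. *)
Lemma deriv_Psi m : (Psi m.+1)^`() =
  - (a * (1 - al m.+1 ^+ 2))%:P * (Psi m - (al m.+2)%:P * Phi m).
Proof.
apply/eqP; rewrite -subr_eq0; apply/eqP.
have sm r : (size (Psi r)^`() <= r)%N.
  apply/leq_sizeP => j rj; rewrite coef_deriv nth_default ?mul0rn//.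
  exact: leq_trans (size_Psi _) _.
apply: (@bform_nondeg m.+1).
  rewrite mulNr opprK (leq_trans (size_polyD _ _))// geq_max sm /=.
  by rewrite size_cmul// size_sub_leq ?size_cmul ?Phi_size ?size_Psi.
move=> q sq; rewrite -Bshift; have sq2 := leqW sq.
have sXq := size_mulX sq.
have := pearson (Psi m.+1) ('X * q).
have -> : B ('X * Psi m.+1) ('X * q) = q`_0 * h m.+1.
  by rewrite Bshift Psi_orth.
have -> : B (Psi m.+1) ('X * ('X * q)) = al m.+2 * h m.+1 * q`_m.
  have -> : Psi m.+1 = Psi m.+2 + (al m.+2)%:P * ('X * Phi m.+1).
    by rewrite [Psi m.+2]szego_rev; ring.
  rewrite !bformE Bshift Psi_orth ?size_mulX// Phi_orth//.
  by rewrite !coefXM /=; ring.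
rewrite (Psi_orth (size_Xderiv sXq)) coef_Xderiv !mul0r subr0 norm_succ => e.
rewrite (_ : 'X * (_ - _) = 'X * (Psi m.+1)^`()
  + (a * (1 - al m.+1 ^+ 2))%:P * ('X * (Psi m - (al m.+2)%:P * Phi m))); last by ring.
rewrite bformDl bformZl [B ('X * (_ - _)) _]Bshift.
rewrite !bformE Psi_orth// Phi_orth// -[RHS]e; ring.
Qed.

Lemma Psi_ode m : 'X^2 * (Psi m)^`() = a%:P *
  (((al m)%:P * (-'X) + (al m.+1)%:P) * Phi m.+1
   + ((al m.+1 ^+ 2)%:P - 'X^2) * Psi m).
Proof.
case: m => [|m].
  (* As [al 0 = -1] and Phi 1 = X - al 1, the bracket is (X + al 1)(X - al 1) + (al 1)^2 - X^2 = 0: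
     the convention alpha_(-1) = -1 covers this case. *)
  rewrite Psi0 -[1 : {poly F}]/(1%:P) derivC mulr0 al0 szego Phi0 Psi0 polyC_exp.
  by rewrite polyCN polyC1; ring.
rewrite deriv_Psi [Phi m.+2]szego.
(* The factor [1 - al m.+1 ^+ 2] of [deriv_Psi] is what [PsiM] and [PhiM] absorb to raise the index
   without division. *)
transitivity (- a%:P * 'X * ('X * ((1 - al m.+1 ^+ 2)%:P * Psi m)
   - (al m.+2)%:P * ((1 - al m.+1 ^+ 2)%:P * ('X * Phi m)))); first by rewrite polyCM; ring.
by rewrite PsiM PhiM polyC_exp; ring.
Qed.

(** * Cauchy transforms of the polynomials: determinant and differential equations *)

Section CauchyTransform.
(* [T n p] stands for the Cauchy transform at [z] of [p(t) nu(t) t^-n], and [w]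
   for [1 / (2 pi)]; the index is shifted because [t^-n dt = i t^(1-n) dtheta]. *)
Variables (w z : F) (T : nat -> {poly F} -> F).
Hypothesis Tlin : forall n c p q, T n (c%:P * p + q) = c * T n p + T n q.
Hypothesis TsubX : forall n p, T n.+1 (('X - z%:P) * p) = w * B p 'X^n.
Hypothesis TX : forall n p, T n.+1 ('X * p) = T n p.

Lemma cauchy0 n : T n 0 = 0.
Proof. by have := Tlin n (-1) 0 0; rewrite mulr0 addr0 mulN1r addNr. Qed.
Lemma cauchyD n p q : T n (p + q) = T n p + T n q.
Proof. by have := Tlin n 1 p q; rewrite !mul1r. Qed.
Lemma cauchyZ n c p : T n (c%:P * p) = c * T n p.
Proof. by have := Tlin n c p 0; rewrite !addr0 cauchy0 addr0. Qed.
Lemma cauchyN n p : T n (- p) = - T n p.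
Proof. by have := cauchyZ n (-1) p; rewrite polyCN !mulN1r. Qed.
Definition cauchyE := (cauchyD, cauchyN, cauchyZ, cauchy0).

Lemma cauchyX n p : T n.+1 ('X * p) = z * T n.+1 p + w * B p 'X^n.
Proof.
have <- := TsubX n p; rewrite -cauchyZ -cauchyD; congr (T _ _); ring.
Qed.

Lemma size_XnS n : (size ('X^n : {poly F}) <= n.+1)%N.
Proof. by rewrite size_polyXn. Qed.

(** Both columns follow the Szego recursion, so the determinant gains the factor [1 - al m.+1 ^+ 2]
    at each step, exactly as [h] does. In [e2] the extra term of [cauchyX] vanishes because
    [Psi m.+1] is orthogonal to ['X^m.+1]. *)
Lemma cauchy_det m :
  T m.+1 (Phi m.+1) * (Psi m).[z] - (Phi m.+1).[z] * T m.+1 (Psi m) = w * h m.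
Proof.
elim: m => [|m IHm].
  rewrite szego Phi0 Psi0 !cauchyE cauchyX !hornerE -Phi0.
  rewrite Phi_orth ?size_XnS// expr0 coefC /=; ring.
have e1 : T m.+2 (Phi m.+2) = T m.+1 (Phi m.+1) - al m.+2 * T m.+2 (Psi m.+1).
  by rewrite szego !cauchyE TX.
have e2 : (1 - al m.+1 ^+ 2) * T m.+1 (Psi m) = z * T m.+2 (Psi m.+1)
    + al m.+1 * T m.+1 (Phi m.+1).
  rewrite -cauchyZ PsiM !cauchyE -TX cauchyX Psi_orth ?size_XnS// coefXn /=; ring.
have e3 : (1 - al m.+1 ^+ 2) * (Psi m).[z] = (Psi m.+1).[z] + al m.+1 * (Phi m.+1).[z].
  by have := congr1 (horner^~ z) (PsiM m); rewrite !hornerE.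
have e4 : (Phi m.+2).[z] = z * (Phi m.+1).[z] - al m.+2 * (Psi m.+1).[z].
  by rewrite [Phi m.+2]szego !hornerE.
rewrite norm_succ mulrCA -IHm mulrBr [_ * (_ * (Psi m).[z])]mulrCA e3.
rewrite [_ * (_ * T m.+1 (Psi m))]mulrCA e2 e1 e4; ring.
Qed.

(** The left-hand side is the value of [z ^+ 2] times the derivative of the transform after
    integration by parts. [Phi_ode] removes the derivative and [cauchyX] turns each ['X] into [z];
    the moments this creates cancel by [orth]. *)
Lemma cauchy_Phi_ode m :
  T m.+1 ('X^2 * (Phi m.+1)^`() + a%:P * ('X^2 - 1) * Phi m.+1
          - m.+1%:R%:P * 'X * Phi m.+1) + w * B (Phi m.+1) 'X^m =
  (a * (1 - al m.+1 ^+ 2) - a + a * z ^+ 2) * T m.+1 (Phi m.+1)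
  + a * (1 - al m.+1 ^+ 2) * (al m.+1 - al m.+2 * z) * T m.+1 (Psi m).
Proof.
rewrite Phi_ode; set b := 1 - _.
have sX1 : (size ('X^m : {poly F}) <= m.+2)%N by exact: leqW (size_XnS m).
have sX2 : (size ('X^m : {poly F}) <= m.+3)%N by exact: leqW.
have orth : B ('X * Phi m.+1) 'X^m = al m.+2 * b * B (Psi m) 'X^m.
  rewrite -mulrA -bformZl PsiM.
  have -> : 'X * Phi m.+1 = Phi m.+2 + (al m.+2)%:P * Psi m.+1.
    by rewrite [Phi m.+2]szego; ring.
  rewrite !bformE !Phi_orth// !coefXn.
  have -> : (m.+2 == m)%N = false by lia.
  have -> : (m.+1 == m)%N = false by lia.
  by rewrite mulr0n; ring.
have -> : B (Phi m.+1) 'X^m = 0.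
  by rewrite Phi_orth// coefXn (_ : (m.+1 == m)%N = false) ?mul0r//; lia.
rewrite (_ : _ + _ - _ = (a * b - a)%:P * Phi m.+1 + a%:P * ('X * ('X * Phi m.+1))
   + (a * b * al m.+1)%:P * Psi m - (a * b * al m.+2)%:P * ('X * Psi m)); last first.
  by rewrite polyCB !polyCM; ring.
rewrite !cauchyE !cauchyX orth.
have -> : B (Phi m.+1) 'X^m = 0.
  by rewrite Phi_orth// coefXn (_ : (m.+1 == m)%N = false) ?mul0r//; lia.
ring.
Qed.

Lemma cauchy_Psi_ode m :
  T m.+1 ('X^2 * (Psi m)^`() + a%:P * ('X^2 - 1) * Psi m
          - m.+1%:R%:P * 'X * Psi m) + w * B (Psi m) 'X^m =
  a * (al m.+1 - al m * z) * T m.+1 (Phi m.+1)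
  - (a * (1 - al m.+1 ^+ 2) + m.+1%:R * z) * T m.+1 (Psi m).
Proof.
rewrite Psi_ode.
rewrite (_ : _ + _ - _ = (a * al m.+1)%:P * Phi m.+1 - (a * al m)%:P * ('X * Phi m.+1)
   + (a * al m.+1 ^+ 2 - a)%:P * Psi m - (m.+1%:R)%:P * ('X * Psi m)); last first.
  by rewrite polyCB !polyCM; ring.
rewrite !cauchyE !cauchyX Psi_orth ?size_XnS// (Phi_orth (leqW (size_XnS m))).
rewrite !coefXn (_ : (m.+1 == m)%N = false); last by lia.
(* The leftover moments add up to (1 - (m + 1)) w B(Psi m, X^m): for m = 0 the coefficient is zero,
   for m > 0 the pairing is. *)
by have [<-|m0] := eqVneq 0%N m; rewrite /= ?mulr0n ?mulr1n; ring.
Qed.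

End CauchyTransform.
End Orthogonal.
End PearsonForm.

(** * Complex-valued functions of a real variable *)

Section ComplexValued.
Variable R : realType.
Local Notation C := R[i].
Implicit Types g h : R -> C.

(** [R[i]] carries here its structure of normed module over itself, so derivatives along a real
    parameter are taken on real and imaginary parts, as in [circle_integral]. *)
Definition cderiv g g' := forall t : R,
  is_derive t 1 (fun t => complex.Re (g t)) (complex.Re (g' t)) /\
  is_derive t 1 (fun t => complex.Im (g t)) (complex.Im (g' t)).

Definition ccont g := continuous (fun t => complex.Re (g t)) /\
  continuous (fun t => complex.Im (g t)).

Lemma cReD (x y : C) : complex.Re (x + y) = complex.Re x + complex.Re y.
Proof. by case: x y => [? ?] [? ?]. Qed.
Lemma cImD (x y : C) : complex.Im (x + y) = complex.Im x + complex.Im y.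
Proof. by case: x y => [? ?] [? ?]. Qed.
Lemma cReM (x y : C) : complex.Re (x * y) =
  complex.Re x * complex.Re y - complex.Im x * complex.Im y.
Proof. by case: x y => [? ?] [? ?]. Qed.
Lemma cImM (x y : C) : complex.Im (x * y) =
  complex.Re x * complex.Im y + complex.Im x * complex.Re y.
Proof. by case: x y => [? ?] [? ?]. Qed.
Lemma cReV (x : C) : complex.Re x^-1 =
  complex.Re x * (complex.Re x ^+ 2 + complex.Im x ^+ 2)^-1.
Proof. by case: x. Qed.
Lemma cImV (x : C) : complex.Im x^-1 =
  - (complex.Im x * (complex.Re x ^+ 2 + complex.Im x ^+ 2)^-1).
Proof. by case: x. Qed.

Lemma complex_ext (x y : C) :
  complex.Re x = complex.Re y -> complex.Im x = complex.Im y -> x = y.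
Proof. by case: x y => [? ?] [? ?] /= -> ->. Qed.

Lemma eq_cderiv g g' h h' : cderiv g g' -> g =1 h -> g' =1 h' -> cderiv h h'.
Proof.
by move=> dg /funext <- /funext <-.
Qed.

Lemma cderiv_cst c : cderiv (fun=> c) (fun=> 0).
Proof. by move=> t; split; exact: is_derive_cst. Qed.

Lemma cderivD g g' h h' : cderiv g g' -> cderiv h h' ->
  cderiv (fun t => g t + h t) (fun t => g' t + h' t).
Proof.
move=> dg dh t; have [g1 g2] := dg t; have [h1 h2] := dh t.
rewrite cReD cImD; split.
- by under eq_fun do rewrite cReD; exact: is_deriveD.
- by under eq_fun do rewrite cImD; exact: is_deriveD.
Qed.

Lemma cderivM g g' h h' : cderiv g g' -> cderiv h h' ->
  cderiv (fun t => g t * h t) (fun t => g' t * h t + g t * h' t).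
Proof.
move=> dg dh t; have [g1 g2] := dg t; have [h1 h2] := dh t.
rewrite cReD cImD !cReM !cImM; split.
- under eq_fun do rewrite cReM.
  apply: is_derive_eq; rewrite /GRing.scale /=; ring.
- under eq_fun do rewrite cImM.
  apply: is_derive_eq; rewrite /GRing.scale /=; ring.
Qed.

Lemma cderivV g g' : (forall t, g t != 0) -> cderiv g g' ->
  cderiv (fun t => (g t)^-1) (fun t => - g' t / g t ^+ 2).
Proof.
move=> g0 dg t; have [g1 g2] := dg t.
have := g0 t; case E : (g t) => [x y] xy0.
have n0 : x ^+ 2 + y ^+ 2 != 0.
  apply: contra xy0; rewrite paddr_eq0 ?sqr_ge0// !sqrf_eq0.
  by case/andP=> /eqP -> /eqP ->.
pose n := fun t => complex.Re (g t) ^+ 2 + complex.Im (g t) ^+ 2.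
have nt0 : n t != 0 by rewrite /n E.
have dn : is_derive t 1 n (2 * (x * complex.Re (g' t) + y * complex.Im (g' t))).
  rewrite /n; apply: is_derive_eq.
  rewrite E /= /GRing.scale /=; ring.
have dnV := is_deriveV nt0 dn.
split.
- under eq_fun do rewrite cReV.
  apply: is_derive_eq; rewrite /GRing.scale /= E /= cReM.
  rewrite cReV cImV {1}/n E; case: (g' t) => u v /=.
  (* The squared modulus of g^2 is the square of that of g, so [field] meets a single
     denominator. *)
  by rewrite (_ : _ ^+ 2 + (x * y + y * x) ^+ 2 = (x ^+ 2 + y ^+ 2) ^+ 2); [field|ring].
- under eq_fun do rewrite cImV.
  apply: is_derive_eq; rewrite /GRing.scale /= E /= cImM.
  rewrite cReV cImV {1}/n E; case: (g' t) => u v /=.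
  by rewrite (_ : _ ^+ 2 + (x * y + y * x) ^+ 2 = (x ^+ 2 + y ^+ 2) ^+ 2); [field|ring].
Qed.

Lemma cderivX g g' n : cderiv g g' ->
  cderiv (fun t => g t ^+ n) (fun t => n%:R * g t ^+ n.-1 * g' t).
Proof.
move=> dg; elim: n => [|n IHn].
  by apply: (eq_cderiv (cderiv_cst 1)) => // t; rewrite !mul0r.
apply: (eq_cderiv (cderivM dg IHn)) => [t|t]; first by rewrite exprS.
case: n {IHn} => [|n] /=; first by rewrite !expr0; ring.
by rewrite -[n.+2%:R]natr1 exprS; ring.
Qed.

Lemma cderiv_poly (p : {poly C}) g g' : cderiv g g' ->
  cderiv (fun t => p.[g t]) (fun t => p^`().[g t] * g' t).
Proof.
move=> dg; elim/poly_ind: p => [|p c IHp].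
  by apply: (eq_cderiv (cderiv_cst 0)) => t; rewrite ?deriv0 !horner0 ?mul0r.
apply: (eq_cderiv (cderivD (cderivM IHp dg) (cderiv_cst c))) => t.
  by rewrite !hornerE.
by rewrite derivD derivM derivX derivC !hornerE; ring.
Qed.

Lemma cderiv_cis : cderiv (@cis R) (fun t => 'i * cis t).
Proof.
move=> t; have -> : 'i * cis t = (- sin t) +i* cos t by simpc.
by split; [exact: is_derive_cos|exact: is_derive_sin].
Qed.

Lemma cderiv_cisN : cderiv (fun t => @cis R (- t)) (fun t => - 'i * cis (- t)).
Proof.
move=> t; have -> : - 'i * cis (- t) = (- sin t) +i* - cos t.
  by rewrite /cis cosN sinN; simpc.
split.
  by under eq_fun do rewrite /= cosN; exact: is_derive_cos.
by under eq_fun do rewrite /= sinN; apply: is_deriveN; exact: is_derive_sin.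
Qed.

Definition weight (l t : R) : C := (expR (l * cos t))%:C.

Lemma norm_i : `|'i%R : C| = 1.
Proof. by rewrite normc_def /= expr0n expr1n add0r sqrtr1. Qed.

Lemma mulii : ('i%R : C) * 'i%R = -1.
Proof. by rewrite -expr2 sqr_i. Qed.

Lemma cis_sub_cisN t : @cis R t - cis (- t) = 2 * ('i * (sin t)%:C).
Proof.
rewrite mulr_natl mulr2n; apply: complex_ext; rewrite /cis /= ?cosN ?sinN; ring.
Qed.

(** The logarithmic derivative - l sin t is expressed through [cis t] and [cis (- t)], which later
    act as multiplication by ['X] in either argument of the form. *)
Lemma cderiv_weight l :
  cderiv (weight l) (fun t => l%:C / 2 * ('i * (cis t - cis (- t))) * weight l t).
Proof.
have E t : l%:C / 2 * ('i * (cis t - cis (- t))) * weight l t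
    = (- (l * sin t) * expR (l * cos t))%:C :> C.
  rewrite cis_sub_cisN (mulrCA 'i) (mulrA 'i) mulii mulN1r.
  have -> : l%:C / 2 * (2 * - (sin t)%:C) = (- (l * sin t))%:C.
    by rewrite rmorphN rmorphM mulrA divfK ?pnatr_eq0// mulrN.
  by rewrite /weight -rmorphM.
move=> t; rewrite E; split; last exact: is_derive_cst.
rewrite /weight /=.
have dl : is_derive t 1 (fun t => l * cos t) (- (l * sin t)).
  by apply: is_derive_eq; rewrite /GRing.scale /=; ring.
have := @is_derive1_comp _ expR (fun t => l * cos t) t _ _ (is_derive_expR _) dl.
by rewrite mulrC.
Qed.

Lemma cderiv_ccont g g' : cderiv g g' -> ccont g.
Proof.
move=> dg; split => t; have [g1 g2] := dg t;
  by apply/differentiable_continuous/derivable1_diffP; apply: ex_derive.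
Qed.

Lemma eq_ccont g h : ccont g -> g =1 h -> ccont h.
Proof. by move=> cg /funext <-. Qed.

Lemma ccontD g h : ccont g -> ccont h -> ccont (fun t => g t + h t).
Proof.
move=> [g1 g2] [h1 h2]; split=> t.
- under eq_fun do rewrite cReD; exact: cvgD (g1 t) (h1 t).
- under eq_fun do rewrite cImD; exact: cvgD (g2 t) (h2 t).
Qed.

Lemma ccontM g h : ccont g -> ccont h -> ccont (fun t => g t * h t).
Proof.
move=> [g1 g2] [h1 h2]; split=> t.
- under eq_fun do rewrite cReM.
  exact: cvgB (cvgM (g1 t) (h1 t)) (cvgM (g2 t) (h2 t)).
- under eq_fun do rewrite cImM.
  exact: cvgD (cvgM (g1 t) (h2 t)) (cvgM (g2 t) (h1 t)).
Qed.

Lemma ccont_cst c : ccont (fun=> c).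
Proof. exact: cderiv_ccont (cderiv_cst c). Qed.


Lemma ccontX g n : ccont g -> ccont (fun t => g t ^+ n).
Proof.
move=> cg; elim: n => [|n IHn]; first exact: ccont_cst.
by apply: (eq_ccont (ccontM cg IHn)) => t; rewrite exprS.
Qed.

Local Notation mu := (@lebesgue_measure R).

Definition cint g : C :=
  (\int[mu]_(t in `[0%R, (2 * pi)%R]) complex.Re (g t))
  +i* (\int[mu]_(t in `[0%R, (2 * pi)%R]) complex.Im (g t)).

Lemma circle_integralE (f : C -> C) :
  circle_integral f = cint (fun t => f (cis t) * ('i * cis t)).
Proof. by []. Qed.

Lemma eq_cint g h : g =1 h -> cint g = cint h.
Proof. by move=> /funext ->. Qed.

Lemma continuous_integrable (f : R -> R) (a b : R) :
  continuous f -> mu.-integrable `[a, b]%classic (EFin \o f).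
Proof.
move=> cf; apply: continuous_compact_integrable; first exact: segment_compact.
exact: continuous_subspaceT.
Qed.

Lemma cintD g h : ccont g -> ccont h ->
  cint (fun t => g t + h t) = cint g + cint h.
Proof.
move=> [g1 g2] [h1 h2]; rewrite /cint.
under eq_Rintegral do rewrite cReD.
under [X in _ +i* X]eq_Rintegral do rewrite cImD.
by rewrite !RintegralD//; exact: continuous_integrable.
Qed.

Lemma continuous_integrableZ (c : R) (f : R -> R) (a b : R) :
  continuous f -> mu.-integrable `[a, b]%classic (EFin \o (fun t => c * f t)).
Proof.
move=> cf; apply: (@continuous_integrable (fun t => c * f t)) => t.
by apply: cvgM; [exact: cvg_cst|exact: cf].
Qed.

Lemma cintZ c g : ccont g -> cint (fun t => c * g t) = c * cint g.
Proof.
move=> [g1 g2]; apply: complex_ext; rewrite ?cReM ?cImM /cint /=.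
- under eq_Rintegral do rewrite cReM.
  by rewrite RintegralB ?RintegralZl//;
    [exact: continuous_integrable..|exact: continuous_integrableZ|exact: continuous_integrableZ].
- under eq_Rintegral do rewrite cImM.
  by rewrite RintegralD ?RintegralZl//;
    [exact: continuous_integrable..|exact: continuous_integrableZ|exact: continuous_integrableZ].
Qed.

Lemma cint_conj g : ccont g -> conjc (cint g) = cint (fun t => conjc (g t)).
Proof.
move=> [g1 g2]; apply: complex_ext; rewrite /cint /=.
- by apply: eq_Rintegral => t _; case: (g t).
- rewrite -mulN1r -RintegralZl//; last exact: continuous_integrable.
  by apply: eq_Rintegral => t _; case: (g t) => x y; rewrite mulN1r.
Qed.

Lemma cint_deriv g g' : cderiv g g' -> ccont g' -> g (2 * pi) = g 0 -> cint g' = 0.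
Proof.
move=> dg [c1 c2] per.
have FTC (F f : R -> R) : (forall t : R, is_derive t 1 F (f t)) -> continuous f ->
    F (2 * pi) = F 0 -> \int[mu]_(t in `[0%R, (2 * pi)%R]) f t = 0.
  move=> dF cf FE; have pi0 : 0 < 2 * pi :> R by rewrite mulr_gt0 ?pi_gt0.
  have cF : continuous F.
    by move=> t; apply/differentiable_continuous/derivable1_diffP; case: (dF t).
  rewrite /Rintegral (@continuous_FTC2 _ f F)//.
  - by rewrite FE subee.
  - exact: continuous_subspaceT.
  - split.
    + by move=> t _; case: (dF t).
    + by apply: cvg_at_right_filter; exact: cF.
    + by apply: cvg_at_left_filter; exact: cF.
  - by move=> t _; rewrite derive1E; case: (dF t).
apply: complex_ext.
- by apply: (FTC (fun t => complex.Re (g t))); [move=> t; case: (dg t)| |rewrite per].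
- by apply: (FTC (fun t => complex.Im (g t))); [move=> t; case: (dg t)| |rewrite per].
Qed.

Lemma norm_le_ReIm (x : C) :
  `|x| <= (`|complex.Re x| + `|complex.Im x|)%:C.
Proof.
have nR (y : R) : `|y%:C| = `|y|%:C by rewrite normc_def /= expr0n addr0 sqrtr_sqr.
rewrite {1}(complexE x) (le_trans (ler_normD _ _))//.
by rewrite normrM norm_i mul1r !nR -rmorphD.
Qed.

(** The crude constant comes from 2 pi M for the real and 2 pi M for the imaginary part. *)
Lemma cint_bound g (M : R) : ccont g -> (forall t, 0 <= t <= 2 * pi -> `|g t| <= M%:C) ->
  `|cint g| <= (4 * pi * M)%:C.
Proof.
move=> [g1 g2] gM.
have bnd (f : R -> R) : continuous f -> (forall t, 0 <= t <= 2 * pi -> `|f t| <= M) ->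
    `|\int[mu]_(t in `[0%R, (2 * pi)%R]) f t| <= 2 * pi * M.
  move=> cf fM; have ifR := @continuous_integrable f 0 (2 * pi) cf.
  have pi0 : 0 <= 2 * pi :> R by rewrite mulr_ge0 ?pi_ge0.
  apply: (le_trans (le_normr_Rintegral _ ifR)) => //.
  have icst : mu.-integrable `[0%R, 2 * pi]%classic (EFin \o cst M).
    by apply: continuous_integrable; exact: cst_continuous.
  apply: le_trans (@le_Rintegral _ _ _ mu _ (fun t => `|f t|) (cst M) _ _ icst _) _ => //.
  - apply: (@continuous_integrable (fun t => `|f t|)) => t.
    by apply: cvg_norm; exact: cf.
  - rewrite Rintegral_cst//= lebesgue_measure_itv /= lte_fin mulr_gt0 ?pi_gt0//.
    by rewrite EFinN sube0 mulrC.
have Re_le t : 0 <= t <= 2 * pi -> `|complex.Re (g t)| <= M.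
  by move=> tpi; rewrite -lecR; apply: le_trans (gM t tpi); exact: normc_ge_Re.
have Im_le t : 0 <= t <= 2 * pi -> `|complex.Im (g t)| <= M.
  move=> tpi; rewrite -lecR; apply: le_trans (gM t tpi).
  rewrite (_ : complex.Im (g t) = complex.Re (- 'i * g t)).
    by rewrite (le_trans (normc_ge_Re _))// normrM normrN norm_i mul1r.
  by case: (g t) => x y; rewrite cReM /=; ring.
rewrite (le_trans (norm_le_ReIm _))// lecR.
rewrite (_ : 4 * pi * M = 2 * pi * M + 2 * pi * M); last by ring.
by rewrite lerD// bnd.
Qed.

Lemma ccont_bounded g : ccont g ->
  exists M : R, forall t, 0 <= t <= 2 * pi -> `|g t| <= M%:C.
Proof.
move=> [g1 g2]; have pi0 : 0 <= 2 * pi :> R by rewrite mulr_ge0 ?pi_ge0.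
pose f t := `|complex.Re (g t)| + `|complex.Im (g t)|.
have cf : continuous f.
  by move=> t; apply: cvgD; apply: cvg_norm; [exact: g1|exact: g2].
have [c _ fc] := @EVT_max R f 0 (2 * pi) pi0 (continuous_subspaceT cf).
exists (f c) => t tpi; apply: le_trans (norm_le_ReIm _) _.
by rewrite lecR; apply: fc; rewrite in_itv.
Qed.

End ComplexValued.

(** * Complex derivatives *)

Section ComplexDerivative.
Variable R : realType.
Local Notation C := R[i].

Lemma is_derive_cvg (f : C -> C) (z L : C) :
  (fun h : C => h^-1 *: (f (h + z) - f z)) @ 0^' --> L -> is_derive z (1:C) f L.
Proof.
move=> H; have H' : (fun h : C => h^-1 *: ((f \o shift z) (h *: (1:C)) - f z)) @ 0^' --> L.
  apply: cvg_trans H; apply: near_eq_cvg; apply: nearW => h /=.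
  by rewrite /GRing.scale /= mulr1.
apply: DeriveDef; first by apply/cvg_ex; exists L.
exact: cvg_lim H'.
Qed.

Lemma norm_Re_real (x : C) : (complex.Re `|x|)%:C = `|x|.
Proof. by rewrite RRe_real// normr_real. Qed.

Lemma is_derive_quadratic (f : C -> C) (z L : C) (K d : R) : 0 < d ->
  (forall h, h != 0 -> `|h| <= d%:C ->
     `|f (h + z) - f z - L * h| <= K%:C * `|h| ^+ 2) ->
  is_derive z (1:C) f L.
Proof.
move=> d0 Kf; apply: is_derive_cvg; apply/cvgrPdist_le => /= e e0.
(* [K] may be zero or negative; this majorant is positive and can be divided by. *)
have K1 : 0 < (`|K| + 1)%:C :> C by rewrite ltcR ltr_wpDl.
near=> h.
have h0 : h != 0 by near: h; exact: nbhs_dnbhs_neq.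
have hd : `|h| <= d%:C by near: h; apply: dnbhs0_le; rewrite ltcR.
have he : `|h| <= e / (`|K| + 1)%:C by near: h; apply: dnbhs0_le; rewrite divr_gt0.
rewrite distrC /GRing.scale /=.
rewrite (_ : _ - L = h^-1 * (f (h + z) - f z - L * h)); last by field.
rewrite normrM normfV ler_pdivrMl ?normr_gt0//.
apply: le_trans (Kf _ h0 hd) _.
rewrite expr2 mulrCA ler_wpM2l//.
apply: (@le_trans _ _ ((`|K| + 1)%:C * `|h|)).
  by rewrite ler_wpM2r// lecR (le_trans (ler_norm _))// ler_wpDr.
by rewrite mulrC -ler_pdivlMr.
Unshelve. all: by end_near. Qed.

Lemma is_deriveM_C (f g : C -> C) (z df dg : C) :
  is_derive z (1:C) f df -> is_derive z (1:C) g dg ->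
  is_derive z (1:C) (fun w => f w * g w) (df * g z + f z * dg).
Proof.
move=> hf hg; rewrite (_ : _ + _ = f z *: dg + g z *: df); first exact: is_deriveM.
by rewrite /GRing.scale /= addrC (mulrC df).
Qed.

Lemma is_deriveD_C (f g : C -> C) (z df dg : C) :
  is_derive z (1:C) f df -> is_derive z (1:C) g dg ->
  is_derive z (1:C) (fun w => f w + g w) (df + dg).
Proof. by move=> hf hg; exact: (is_deriveD hf hg). Qed.

Lemma is_derive_quotient_cvg (f : C -> C) (z L : C) : is_derive z (1:C) f L ->
  (fun h : C => h^-1 *: (f (h + z) - f z)) @ 0^' --> L.
Proof.
move=> [df <-]; move: df => /cvg_ex[L' H].
rewrite /derive (cvg_lim _ H)//.
apply: cvg_trans H; apply: near_eq_cvg; apply: nearW => h /=.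
by rewrite /GRing.scale /= mulr1.
Qed.

(** Caratheodory's form of differentiability. With its converse [slope_is_derive] it gives the chain
    rule without a case distinction on [f w = f z]. *)
Lemma is_derive_slope (f : C -> C) (z L : C) : is_derive z (1:C) f L ->
  exists phi : C -> C, [/\ {for z, continuous phi}, phi z = L
    & forall w, f w - f z = phi w * (w - z)].
Proof.
move=> /is_derive_quotient_cvg H.
exists (fun w => if w == z then L else (w - z)^-1 * (f w - f z)); split; first last.
- move=> w; have [->|wz] := eqVneq w z; first by rewrite !subrr mulr0.
  by rewrite mulrAC mulVf ?mul1r// subr_eq0.
- by rewrite eqxx.
apply/(@cvgrPdist_le _ _ _ (nbhs z)) => e e0.
have /cvgrPdist_le /(_ e e0) /nbhs_ballP[d /= d0 Hd] := H.
near=> w; rewrite eqxx; have [_|wz] := eqVneq w z; first by rewrite subrr normr0 ltW.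
have := Hd (w - z); rewrite /= subrK; apply.
- rewrite /ball /= sub0r normrN distrC.
  by near: w; apply: nbhsx_ballx.
- by rewrite subr_eq0.
Unshelve. all: by end_near. Qed.

Lemma slope_is_derive (f phi : C -> C) (z : C) : {for z, continuous phi} ->
  (\forall w \near z, f w - f z = phi w * (w - z)) -> is_derive z (1:C) f (phi z).
Proof.
move=> cphi fphi; apply: is_derive_cvg; apply/cvgrPdist_le => /= e e0.
have /(@cvgrPdist_le _ _ _ (nbhs z))/(_ e e0) H := cphi.
have [d /= d0 Hd] := (nbhs_ballP _ _).1 (filterI H fphi).
near=> h.
have h0 : h != 0 by near: h; exact: nbhs_dnbhs_neq.
have [|H1 H2] := Hd (h + z).
  rewrite /ball /= opprD addrCA subrr addr0 normrN.
  by near: h; apply: dnbhs0_lt.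
by rewrite H2 addrK /GRing.scale /= mulrC mulfK.
Unshelve. all: by end_near. Qed.

Lemma is_derive_continuous (f : C -> C) (z L : C) :
  is_derive z (1:C) f L -> {for z, continuous f}.
Proof.
by move=> [hf _]; apply: differentiable_continuous; apply/derivable1_diffP.
Qed.

Lemma is_derive_comp_C (f g : C -> C) (z df dg : C) :
  is_derive z (1:C) f df -> is_derive (f z) (1:C) g dg ->
  is_derive z (1:C) (fun w => g (f w)) (dg * df).
Proof.
move=> hf hg; have cf := is_derive_continuous hf.
have [phi [cphi <- fE]] := is_derive_slope hf.
have [psi [cpsi <- gE]] := is_derive_slope hg.
apply: (@slope_is_derive _ (fun w => psi (f w) * phi w)).
  have c2 : (psi \o f) w @[w --> z] --> psi (f z).
    exact: (@continuous_comp _ _ _ f psi z cf cpsi).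
  exact: (cvgM c2 cphi).
by apply: (@filterE _ (nbhs z)) => w; rewrite gE fE mulrA.
Qed.

Lemma is_deriveV_C (f : C -> C) (z df : C) : f z != 0 ->
  is_derive z (1:C) f df -> is_derive z (1:C) (fun w => (f w)^-1) (- df / f z ^+ 2).
Proof.
move=> f0 [hf hd]; apply: DeriveDef; first exact: derivableV.
by rewrite deriveV// hd /GRing.scale /= mulNr mulrC mulNr.
Qed.

Lemma is_deriveX_C (f : C -> C) (z df : C) n :
  is_derive z (1:C) f df ->
  is_derive z (1:C) (fun w => f w ^+ n) (n%:R * f z ^+ n.-1 * df).
Proof.
move=> hf; elim: n => [|n IHn]; first by rewrite !mul0r; exact: is_derive_cst.
rewrite (_ : (fun w => _) = (fun w => f w * f w ^+ n)); last first.
  by apply/funext => w; rewrite exprS.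
rewrite (_ : _ * df = df * f z ^+ n + f z * (n%:R * f z ^+ n.-1 * df)).
  exact: is_deriveM_C.
case: n {IHn} => [|n] /=; first by rewrite !expr0; ring.
by rewrite -[n.+2%:R]natr1 exprS; ring.
Qed.

Lemma is_derive_horner_C (p : {poly C}) (z : C) :
  is_derive z (1:C) (fun w => p.[w]) p^`().[z].
Proof.
elim/poly_ind: p => [|p c IHp].
  by rewrite deriv0 horner0; under eq_fun do rewrite horner0; exact: is_derive_cst.
rewrite (_ : (fun w => _) = (fun w => p.[w] * w + c)); last first.
  by apply/funext => w; rewrite !hornerE.
rewrite (_ : _.[z] = p^`().[z] * z + p.[z] * 1 + 0); last first.
  by rewrite derivD derivM derivX derivC !hornerE.
apply: is_deriveD_C (is_derive_cst c z (1:C)).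
exact: is_deriveM_C IHp (is_derive_id z (1:C)).
Qed.

(** From f(w) - f(z) = (r(w) - r(z)) (r(w) + r(z)), the slope of [r] is that of [f] divided by r(w)
    + r(z), which is continuous and nonzero at [z]. *)
Lemma is_derive_sqrt_branch (f r : C -> C) (z df : C) : f z != 0 ->
  sqrt_branch_near f z r -> is_derive z (1:C) f df ->
  is_derive z (1:C) r (df / (2 * r z)).
Proof.
move=> fz0 br hf.
have [rc rz] := nbhs_singleton br.
have rz0 : r z != 0 by apply: contra fz0 => /eqP r0; rewrite -rz r0 expr0n.
have [phi [cphi <- fE]] := is_derive_slope hf.
have csum : {for z, continuous (fun w => r w + r z)}.
  exact: (cvgD rc (@cvg_cst _ (r z) _ (nbhs z) _)).
have sum0 : r z + r z != 0 by rewrite -mulr2n -mulr_natl mulf_neq0// pnatr_eq0.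
rewrite mulr_natl mulr2n.
apply: (@slope_is_derive _ (fun w => phi w / (r w + r z))).
  exact: (cvgM cphi (cvgV sum0 csum)).
have near0 : \forall w \near z, r w + r z != 0 by exact: (cvgr_neq0 _ csum sum0).
near=> w.
have rw0 : r w + r z != 0 by near: w.
have [_ rw] : {for w, continuous r} /\ r w ^+ 2 = f w by near: w.
apply: (mulIf rw0); rewrite -mulrAC divfK// -fE -rw -rz; ring.
Unshelve. all: by end_near. Qed.

End ComplexDerivative.

(** * The complex exponential and Cauchy kernels *)

Section Exponential.
Variable R : realType.
Local Notation C := R[i].

Lemma mvt_bound (f f' : R -> R) (x M : R) :
  (forall t : R, is_derive t 1 f (f' t)) ->
  (forall c, `|c| <= `|x| -> `|f' c| <= M) -> `|f x - f 0| <= M * `|x|.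
Proof.
move=> df f'M.
have cf : continuous f.
  by move=> t; apply/differentiable_continuous/derivable1_diffP; case: (df t).
have [x0|x0] := leP 0 x.
  have [c c0x ->] := MVT_segment x0 (fun t _ => df t) (continuous_subspaceT cf).
  move: c0x; rewrite in_itv /= => /andP[c0 cx].
  rewrite subr0 normrM ler_wpM2r// f'M//.
  by rewrite !ger0_norm.
have [c c0x E] := MVT_segment (ltW x0) (fun t _ => df t) (continuous_subspaceT cf).
move: c0x; rewrite in_itv /= => /andP[xc c0].
rewrite distrC E sub0r normrM normrN ler_wpM2r// f'M//.
by rewrite !ler0_norm ?(ltW x0)// lerN2.
Qed.

Lemma norm_sin_le (x : R) : `|sin x| <= `|x|.
Proof.
have := @mvt_bound sin cos x 1 (fun t => is_derive_sin t) (fun c _ => cos_max c).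
by rewrite sin0 subr0 mul1r.
Qed.

Lemma norm_cosB1_le (x : R) : `|cos x - 1| <= `|x| ^+ 2.
Proof.
have := @mvt_bound cos (fun t => - sin t) x `|x| (fun t => is_derive_cos t).
rewrite cos0 expr2; apply=> c cx; rewrite normrN.
exact: le_trans (norm_sin_le _) cx.
Qed.

Lemma norm_sinB_le (x : R) : `|x| <= 1 -> `|sin x - x| <= `|x| ^+ 2.
Proof.
move=> x1.
have := @mvt_bound (fun t => sin t - t) (fun t => cos t - 1) x `|x|.
rewrite sin0 !subr0 expr2; apply=> c cx.
apply: le_trans (norm_cosB1_le _) _; rewrite expr2.
apply: le_trans (ler_pM _ _ cx cx) _ => //.
by rewrite ler_piMr.
Qed.

Lemma norm_expRB1_le (x : R) : `|x| <= 1 -> `|expR x - 1| <= expR 1 * `|x|.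
Proof.
move=> x1; rewrite -[X in _ - X](expR0 R).
apply: mvt_bound => c cx.
rewrite ger0_norm ?expR_ge0// ler_expR.
exact: le_trans (ler_norm c) (le_trans cx x1).
Qed.

Lemma norm_expRB1B_le (x : R) : `|x| <= 1 ->
  `|expR x - 1 - x| <= expR 1 * `|x| ^+ 2.
Proof.
move=> x1.
have := @mvt_bound (fun t => expR t - t) (fun t => expR t - 1) x (expR 1 * `|x|).
rewrite expR0 subr0 expr2 mulrA -!addrA (addrC (- x)); apply=> c cx.
apply: le_trans (norm_expRB1_le (le_trans cx x1)) _.
by rewrite ler_wpM2l// expR_ge0.
Qed.

Lemma cisD (x y : R) : cis (x + y) = cis x * cis y.
Proof.
apply: complex_ext; rewrite ?cReM ?cImM /cis /=; first exact: cosD.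
by rewrite sinD addrC.
Qed.

Lemma cis0 : cis (0 : R) = 1.
Proof. by rewrite /cis cos0 sin0. Qed.

Lemma cexpD (x y : C) : cexp (x + y) = cexp x * cexp y.
Proof. by rewrite /cexp cReD cImD cisD expRD rmorphM /= mulrACA. Qed.

Lemma cexp_real (x : R) : cexp x%:C = (expR x)%:C.
Proof. by rewrite /cexp /= cis0 mulr1. Qed.

Lemma cexp0 : cexp (0 : C) = 1.
Proof. by rewrite (cexp_real 0) expR0. Qed.

Lemma cexp_neq0 (x : C) : cexp x != 0.
Proof.
have : cexp x * cexp (- x) = 1 by rewrite -cexpD subrr cexp0.
by apply: contra_eq_neq => ->; rewrite mul0r eq_sym oner_eq0.
Qed.

(** For h = x + iy with |h| = n <= 1, the remainder splits into (e^x - 1 - x) + e^x (cos y - 1) and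
    (e^x - 1) y + e^x (sin y - y). Each of the four summands is at most e n^2, whence the constant 4
    e. *)
Lemma is_derive_cexp0 : is_derive (0 : C) (1:C) (@cexp R) 1.
Proof.
apply: (@is_derive_quadratic R _ _ _ (4 * expR 1) 1) => // h h0.
pose n := complex.Re `|h|.
have hn : `|h| = n%:C by rewrite norm_Re_real.
rewrite hn lecR addr0 mul1r -rmorphXn => n1.
have Re_n : `|complex.Re h| <= n by rewrite -lecR -hn normc_ge_Re.
have Im_n : `|complex.Im h| <= n.
  rewrite -lecR -hn (_ : complex.Im h = complex.Re (- 'i * h)).
    by rewrite (le_trans (normc_ge_Re _))// normrM normrN norm_i mul1r.
  by case: (h) => x y; rewrite cReM /=; ring.
rewrite (le_trans (norm_le_ReIm _))// -rmorphM /= lecR cexp0.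
clearbody n; case: h h0 hn Re_n Im_n n1 => x y _ _ /= xn yn n1.
have x1 : `|x| <= 1 := le_trans xn n1.
have y1 : `|y| <= 1 := le_trans yn n1.
have n0 : 0 <= n by apply: le_trans xn.
have x2 : `|x| ^+ 2 <= n ^+ 2 by rewrite lerXn2r ?nnegrE.
have y2 : `|y| ^+ 2 <= n ^+ 2 by rewrite lerXn2r ?nnegrE.
have xy2 : `|x| * `|y| <= n ^+ 2 by rewrite expr2 ler_pM.
have ex : expR x <= expR 1 by rewrite ler_expR (le_trans (ler_norm x)).
have eb u v : 0 <= u <= expR 1 -> `|v| <= n ^+ 2 -> `|u * v| <= expR 1 * n ^+ 2.
  by move=> /andP[u0 ue] vn; rewrite normrM (ger0_norm u0); exact: ler_pM.
have ex0 := expR_ge0 x.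
have H1 : `|expR x * cos y - 1 - x| <= 2 * (expR 1 * n ^+ 2).
  rewrite (_ : _ - x = (expR x - 1 - x) + expR x * (cos y - 1)); last by ring.
  rewrite (le_trans (ler_normD _ _))// (mulrDl 1 1) mul1r lerD//.
    by rewrite (le_trans (norm_expRB1B_le x1))// ler_wpM2l ?expR_ge0.
  apply: eb; first by rewrite ex0.
  exact: le_trans (norm_cosB1_le _) y2.
have H2 : `|expR x * sin y - y| <= 2 * (expR 1 * n ^+ 2).
  rewrite (_ : _ - y = (expR x - 1) * y + expR x * (sin y - y)); last by ring.
  rewrite (le_trans (ler_normD _ _))// (mulrDl 1 1) mul1r lerD//.
    rewrite normrM (le_trans (ler_wpM2r _ (norm_expRB1_le x1)))// -mulrA.
    by rewrite ler_wpM2l ?expR_ge0.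
  apply: eb; first by rewrite ex0.
  exact: le_trans (norm_sinB_le y1) y2.
rewrite !mul0r !subr0 addr0.
rewrite (_ : 4 * _ * _ = 2 * (expR 1 * n ^+ 2) + 2 * (expR 1 * n ^+ 2)); last by ring.
exact: lerD.
Qed.

Lemma is_derive_subr (z c : C) : is_derive z (1:C) (fun w : C => w - c) 1.
Proof.
have := is_deriveD_C (is_derive_id z (1:C)) (is_derive_cst (- c) z (1:C)).
by rewrite addr0.
Qed.

Lemma is_derive_cexp (z : C) : is_derive z (1:C) (@cexp R) (cexp z).
Proof.
have E : @cexp R = (fun w => cexp z * cexp (w - z)).
  by apply/funext => w; rewrite -cexpD addrC subrK.
have d2 : is_derive (z - z) (1:C) (@cexp R) 1 by rewrite subrr; exact: is_derive_cexp0.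
have := is_deriveM_C (is_derive_cst (cexp z) z (1:C)) (is_derive_comp_C (is_derive_subr z z) d2).
by rewrite mul0r add0r !mulr1 /= -E.
Qed.

Lemma is_derive_exp_weight (l : R) (z : C) : z != 0 ->
  is_derive z (1:C) (exp_weight l)
    (l%:C / 2 * (1 - z ^- 2) * exp_weight l z).
Proof.
move=> z0; rewrite /exp_weight.
have dV := is_deriveV_C z0 (is_derive_id z (1:C)).
have d1 : is_derive z (1:C) (fun w : C => l%:C * (w + w^-1) / 2)
    (l%:C / 2 * (1 - z ^- 2)).
  have := is_deriveM_C (is_derive_cst (l%:C / 2) z (1:C))
    (is_deriveD_C (is_derive_id z (1:C)) dV).
  rewrite mul0r add0r mulN1r.
  by rewrite (_ : (fun w : C => _ * _ / _) = (fun w => l%:C / 2 * (w + w^-1)));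
    last by apply/funext => w; rewrite mulrAC.
have := is_derive_comp_C d1 (is_derive_cexp _).
by rewrite mulrC.
Qed.

End Exponential.

(** * Differentiation of Cauchy integrals off the circle *)

Section CauchyKernel.
Variable R : realType.
Local Notation C := R[i].

Lemma norm_cis (t : R) : `|cis t| = 1.
Proof. by rewrite normc_def /cis /= cos2Dsin2 sqrtr1. Qed.

Lemma cis_neq0 (t : R) : cis t != 0.
Proof. by rewrite -normr_gt0 norm_cis ltr01. Qed.

Lemma circle_gap (z : C) : `|z| != 1 ->
  exists2 d : R, 0 < d & forall t, d%:C <= `|cis t - z|.
Proof.
move=> z1; exists (complex.Re `| 1 - `|z| |).
  by rewrite -ltcR norm_Re_real normr_gt0 subr_eq0 eq_sym.
by move=> t; rewrite norm_Re_real -(norm_cis t) ler_dist_dist.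
Qed.

Lemma cis_sub_neq0 (z : C) t : `|z| != 1 -> cis t - z != 0.
Proof. by apply: contra; rewrite subr_eq0 => /eqP <-; rewrite norm_cis. Qed.

Lemma cderiv_cis_sub (z : C) : cderiv (fun t => cis t - z) (fun t => 'i * cis t).
Proof.
by apply: (eq_cderiv (cderivD (@cderiv_cis R) (cderiv_cst (- z)))) => // t; rewrite addr0.
Qed.

Lemma ccont_kernel (z : C) : (forall t, cis t - z != 0) ->
  ccont (fun t => (cis t - z)^-1).
Proof. by move=> z1; exact: cderiv_ccont (cderivV z1 (cderiv_cis_sub z)). Qed.

(** With c = [cis t], 1/(c - z - h) = 1/(c - z) + h/(c - z)^2 + h^2/((c - z - h)(c - z)^2). For |h|
    <= d/2 the circle stays at distance d/2 from z + h, so the last integrand is bounded by |h|^2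
    times 2M/d^3; [cint_bound] adds the factor 4 pi. *)
Lemma is_derive_cauchy (g : R -> C) (z : C) : ccont g -> `|z| != 1 ->
  is_derive z (1:C) (fun w => cint (fun t => g t / (cis t - w)))
    (cint (fun t => g t / (cis t - z) ^+ 2)).
Proof.
move=> cg z1; have [d d0 dgap] := circle_gap z1.
have [M gM] := ccont_bounded cg.
have M0 : 0 <= M.
  have := gM 0; rewrite lexx mulr_ge0 ?pi_ge0// => /(_ isT) gM0.
  by rewrite -lecR; exact: le_trans (normr_ge0 _) gM0.
apply: (@is_derive_quadratic R _ _ _ (4 * pi * (2 * M / d ^+ 3)) (d / 2)).
  by rewrite divr_gt0.
move=> h h0 hd.
have d20 : 0 < d / 2 by rewrite divr_gt0.
have gap2 t : (d / 2)%:C <= `|cis t - (h + z)|.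
  rewrite (_ : _ - (h + z) = (cis t - z) - h); last by ring.
  apply: le_trans (lerB_dist _ _).
  rewrite lerBrDr; apply: le_trans (dgap t).
  by rewrite [X in _ <= X%:C]splitr rmorphD lerD2l.
have nz t : cis t - z != 0 by exact: cis_sub_neq0.
have nzh t : cis t - (h + z) != 0.
  by rewrite -normr_gt0 (lt_le_trans _ (gap2 t))// ltcR.
pose D t := g t / ((cis t - (h + z)) * (cis t - z) ^+ 2).
have cK := ccont_kernel nz; have cKh := ccont_kernel nzh.
have cG : ccont (fun t => g t / (cis t - z) ^+ 2).
  by apply: (eq_ccont (ccontM cg (ccontX 2 cK))) => t; rewrite exprVn.
have cD : ccont D.
  by apply: (eq_ccont (ccontM cG cKh)) => t; rewrite /D; field; rewrite nz nzh.
have -> : cint (fun t => g t / (cis t - (h + z))) =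
    cint (fun t => g t / (cis t - z)) +
    (h * cint (fun t => g t / (cis t - z) ^+ 2) + h ^+ 2 * cint D).
  have cA := ccontM (ccont_cst h) cG.
  have cB := ccontM (ccont_cst (h ^+ 2)) cD.
  have cC := ccontM cg cK.
  rewrite -!cintZ// -(cintD cA cB) -(cintD cC (ccontD cA cB)).
  by apply: eq_cint => t; rewrite /D; field; rewrite nz nzh.
rewrite (_ : _ - _ = h ^+ 2 * cint D); last by ring.
rewrite normrM normrX mulrC ler_wpM2r ?exprn_ge0//.
apply: cint_bound => // t tpi; rewrite /D normrM normfV normrM normrX.
rewrite ler_pdivrMr; last first.
  by rewrite mulr_gt0 ?exprn_gt0 ?normr_gt0.
apply: le_trans (gM t tpi) _.
rewrite [X in X%:C <= _](_ : M = (2 * M / d ^+ 3) * ((d / 2) * d ^+ 2)); last first.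
  by field; rewrite gt_eqF.
rewrite (rmorphM _ (2 * M / d ^+ 3)) ler_wpM2l//.
  by rewrite lecR divr_ge0 ?mulr_ge0 ?exprn_ge0// ltW.
have dC0 : 0 <= d%:C :> C by rewrite lecR ltW.
rewrite rmorphM rmorphXn /=; apply: ler_pM => //.
- by rewrite lecR ltW.
- exact: exprn_ge0.
- by apply: lerXn2r; rewrite ?nnegrE.
Qed.

End CauchyKernel.

(** * The weight and its Cauchy transforms *)

Definition horner_ringE (K : comNzRingType) := (@hornerD K, @hornerN K,
  @hornerM K, @hornerC K, @hornerX K, @hornerXn K).

Section WeightForm.
Variables (R : realType) (l : R).
Local Notation C := R[i].
Implicit Types p q : {poly C}.

Lemma cisN (t : R) : cis (- t) = (cis t)^-1.
Proof.
apply: (mulfI (cis_neq0 t)).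
by rewrite -cisD subrr cis0 divff// cis_neq0.
Qed.

Lemma conj_cis (t : R) : conjc (cis t) = cis (- t).
Proof. by rewrite /cis cosN sinN. Qed.

Lemma cis2pi : cis (2 * pi : R) = 1.
Proof. by rewrite mulr_natl /cis cos2pi sin2pi. Qed.

Lemma i_neq0 : 'i%R != 0 :> C.
Proof. by rewrite -normr_gt0 norm_i ltr01. Qed.

Lemma exp_weight_cis (t : R) : exp_weight l (cis t) = weight l t.
Proof.
rewrite /exp_weight -cisN (_ : _ / 2 = (l * cos t)%:C) ?cexp_real//.
have -> : cis t + cis (- t) = (cos t)%:C * 2.
  rewrite mulr_natr mulr2n; apply: complex_ext; rewrite /cis /= ?cosN ?sinN; ring.
by rewrite mulrA mulfK ?pnatr_eq0// -rmorphM.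
Qed.

Lemma ccont_cis : ccont (@cis R).
Proof. exact: cderiv_ccont (@cderiv_cis R). Qed.
Lemma ccont_cisN : ccont (fun t => @cis R (- t)).
Proof. exact: cderiv_ccont (@cderiv_cisN R). Qed.
Lemma ccont_weight : ccont (weight l).
Proof. exact: cderiv_ccont (cderiv_weight l). Qed.
Lemma ccont_horner p g : ccont g -> ccont (fun t => p.[g t]).
Proof.
move=> cg; elim/poly_ind: p => [|p c IHp].
  by apply: (eq_ccont (ccont_cst 0)) => t; rewrite horner0.
by apply: (eq_ccont (ccontD (ccontM IHp cg) (ccont_cst c))) => t; rewrite !horner_ringE.
Qed.

(** Inserting [cis (- t)] conjugates the variable but not the coefficients of [q];
    [mu_integral_weight_form] relates this to the Hermitian product. *)
Definition weight_form p q : C :=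
  cint (fun t => p.[cis t] * q.[cis (- t)] * weight l t).

Lemma ccont_weight_form p q : ccont (fun t => p.[cis t] * q.[cis (- t)] * weight l t).
Proof.
exact: ccontM (ccontM (ccont_horner p ccont_cis) (ccont_horner q ccont_cisN)) ccont_weight.
Qed.

Lemma weight_form_linl c p q r : weight_form (c%:P * p + q) r = c * weight_form p r + weight_form q r.
Proof.
rewrite /weight_form -(cintZ c (ccont_weight_form p r)).
rewrite -(cintD (ccontM (ccont_cst c) (ccont_weight_form p r)) (ccont_weight_form q r)).
by apply: eq_cint => t; rewrite !horner_ringE; ring.
Qed.

Lemma weight_form_linr c p q r : weight_form r (c%:P * p + q) = c * weight_form r p + weight_form r q.
Proof.
rewrite /weight_form -(cintZ c (ccont_weight_form r p)).
rewrite -(cintD (ccontM (ccont_cst c) (ccont_weight_form r p)) (ccont_weight_form r q)).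
by apply: eq_cint => t; rewrite !horner_ringE; ring.
Qed.

Lemma weight_form_shift p q : weight_form ('X * p) ('X * q) = weight_form p q.
Proof.
apply: eq_cint => t; rewrite !horner_ringE mulrACA -cisD subrr cis0 mul1r//.
Qed.

Lemma weight_form_pearson p q :
  weight_form ('X * p^`()) q - weight_form p ('X * q^`())
  + l%:C / 2 * (weight_form ('X * p) q - weight_form p ('X * q)) = 0.
Proof.
have dG := cderivM (cderivM (cderiv_poly p (@cderiv_cis R))
  (cderiv_poly q (@cderiv_cisN R))) (cderiv_weight l).
have c1 := ccont_weight_form ('X * p^`()) q.
have c2 := ccontM (ccont_cst (-1)) (ccont_weight_form p ('X * q^`())).
have c3 := ccontM (ccont_cst (l%:C / 2)) (ccont_weight_form ('X * p) q).
have c4 := ccontM (ccont_cst (- (l%:C / 2))) (ccont_weight_form p ('X * q)).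
have c12 := ccontD c1 c2; have c34 := ccontD c3 c4; have c1234 := ccontD c12 c34.
(* Differentiating in [t] produces 'i times the Pearson combination; the minus signs come from the
   argument [cis (- t)]. *)
apply: (mulfI i_neq0); rewrite mulr0.
have := cint_deriv (eq_cderiv dG (fun=> erefl) _) (ccontM (ccont_cst 'i%R) c1234).
rewrite cintZ// cintD// cintD// cintD// !cintZ; do ?exact: ccont_weight_form.
rewrite -!/(weight_form _ _) mulN1r mulNr -mulrBr; apply=> [t|].
  by rewrite !horner_ringE; ring.
by rewrite cisN cis2pi invr1 oppr0 cis0 /weight (_ : cos (2 * pi) = cos 0)// cos0
  mulr_natl cos2pi.
Qed.

Lemma mu_integralE f :
  mu_integral (exp_weight l) f = cint (fun t => f (cis t) * weight l t).
Proof.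
rewrite /mu_integral circle_integralE; apply: eq_cint => t.
rewrite exp_weight_cis; field; first by rewrite cis_neq0 i_neq0.
Qed.

Lemma conj_horner p (x : C) : conjc p.[x] = (map_poly conjc p).[conjc x].
Proof. by rewrite horner_map. Qed.

Lemma mu_integral_weight_form p q :
  mu_integral (exp_weight l) (fun z => p.[z] * (q.[z])^*) = weight_form p (map_poly conjc q).
Proof.
rewrite mu_integralE; apply: eq_cint => t.
by rewrite -[Num.conj _]/(conjc _) conj_horner conj_cis.
Qed.

Lemma map_poly_conjK p : map_poly conjc (map_poly conjc p) = p.
Proof.
by apply/polyP => i; rewrite !coef_map /=; exact: conjcK.
Qed.

Lemma weight_form_conj p q :
  conjc (weight_form p q) = weight_form (map_poly conjc q) (map_poly conjc p).
Proof.
rewrite /weight_form cint_conj; last exact: ccont_weight_form.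
apply: eq_cint => t; rewrite !rmorphM /= !conj_horner !conj_cis opprK.
by rewrite oppr0; congr (_ * _); exact: mulrC.
Qed.

Definition cauchy_transform (z : C) n p : C := (2 * pi%:C * 'i)^-1 *
  cint (fun t => p.[cis t] * (weight l t * cis (- t) ^+ n) * ('i * cis t) / (cis t - z)).

Lemma ccont_density n p :
  ccont (fun t => p.[cis t] * (weight l t * cis (- t) ^+ n) * ('i * cis t)).
Proof.
apply: ccontM; first apply: ccontM.
- exact: ccont_horner ccont_cis.
- exact: ccontM ccont_weight (ccontX n ccont_cisN).
- exact: ccontM (ccont_cst _) ccont_cis.
Qed.

Lemma ccont_cauchy z n p : `|z| != 1 -> ccont (fun t =>
  p.[cis t] * (weight l t * cis (- t) ^+ n) * ('i * cis t) / (cis t - z)).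
Proof.
move=> z1; apply: ccontM; first exact: ccont_density.
by apply: ccont_kernel => t; exact: cis_sub_neq0.
Qed.

Lemma cauchy_lin z n c p q : `|z| != 1 ->
  cauchy_transform z n (c%:P * p + q) = c * cauchy_transform z n p + cauchy_transform z n q.
Proof.
move=> z1; rewrite /cauchy_transform mulrCA -mulrDr; congr (_ * _).
have cp := ccont_cauchy n p z1; have cq := ccont_cauchy n q z1.
rewrite -(cintZ c cp) -(cintD (ccontM (ccont_cst c) cp) cq).
by apply: eq_cint => t; rewrite !horner_ringE; ring.
Qed.

Lemma cauchyXS z n p : cauchy_transform z n.+1 ('X * p) = cauchy_transform z n p.
Proof.
rewrite /cauchy_transform; congr (_ * _); apply: eq_cint => t; rewrite !horner_ringE cisN exprS.
congr (_ / _); field; exact: cis_neq0.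
Qed.

Lemma cint_density n p :
  cint (fun t => p.[cis t] * (weight l t * cis (- t) ^+ n.+1) * ('i * cis t))
  = 'i * weight_form p 'X^n.
Proof.
rewrite -(cintZ _ (ccont_weight_form _ _)); apply: eq_cint => t.
rewrite hornerXn cisN exprS; field; exact: cis_neq0.
Qed.

Lemma cauchy_subX z n p : `|z| != 1 ->
  cauchy_transform z n.+1 (('X - z%:P) * p) = (2 * pi%:C)^-1 * weight_form p 'X^n.
Proof.
move=> z1; rewrite /cauchy_transform.
rewrite (eq_cint (h := fun t =>
  p.[cis t] * (weight l t * cis (- t) ^+ n.+1) * ('i * cis t))); last first.
  move=> t; rewrite !horner_ringE -(mulrA (_ - _)) -(mulrA (_ - _)) mulrC mulKf//.
  exact: cis_sub_neq0.
by rewrite cint_density invfM mulrA mulfVK ?i_neq0.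
Qed.

Definition cauchy_transform' (z : C) n p : C := (2 * pi%:C * 'i)^-1 *
  cint (fun t => p.[cis t] * (weight l t * cis (- t) ^+ n) * ('i * cis t) / (cis t - z) ^+ 2).

Lemma is_derive_cauchy_transform z n p : `|z| != 1 ->
  is_derive z (1:C) (fun w => cauchy_transform w n p) (cauchy_transform' z n p).
Proof.
move=> z1; have := is_deriveM_C (is_derive_cst ((2 * pi%:C * 'i)^-1) z (1:C))
  (is_derive_cauchy (ccont_density n p) z1).
by rewrite mul0r add0r.
Qed.

(* Integration by parts on the circle, applied to
   [p(t) nu(t) t^-n * t^2 / (t - z)]. *)
Lemma cauchy_transform'E z n p : `|z| != 1 ->
  z ^+ 2 * cauchy_transform' z n.+1 p =
  cauchy_transform z n.+1 ('X^2 * p^`() + (l%:C / 2)%:P * ('X^2 - 1) * p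
                 - n.+1%:R%:P * 'X * p)
  + (2 * pi%:C)^-1 * weight_form p 'X^n.
Proof.
move=> z1; set q := _ - _.
have nz t : cis t - z != 0 by exact: cis_sub_neq0.
have cK := ccont_kernel nz.
have cD := ccont_density n.+1 p.
have cq := ccont_cauchy n.+1 q z1.
have cD2 : ccont (fun t => p.[cis t] * (weight l t * cis (- t) ^+ n.+1) * ('i * cis t) / (cis t - z) ^+ 2).
  by apply: (eq_ccont (ccontM cD (ccontX 2 cK))) => t; rewrite exprVn.
have dH := cderivM (cderivM (cderivM (cderiv_poly p (@cderiv_cis R))
   (cderivM (cderiv_weight l) (cderivX n.+1 (@cderiv_cisN R))))
   (cderivX 2 (@cderiv_cis R))) (cderivV nz (cderiv_cis_sub z)).
(* Since t^2/(t - z) = t + z + z^2/(t - z), its derivative is 1 - z^2/(t - z)^2: the 1 yields the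
   moment, the rest yields [z ^+ 2 * cauchy_transform']. *)
have c3 := ccontM (ccont_cst (- z ^+ 2)) cD2.
have c12 := ccontD cq cD; have c123 := ccontD c12 c3.
have := cint_deriv (eq_cderiv dH (fun=> erefl) _) c123.
rewrite cintD// cintD// cintZ// cint_density => H.
rewrite /cauchy_transform' /cauchy_transform mulrCA.
have -> : (2 * pi%:C)^-1 * weight_form p 'X^n = (2 * pi%:C * 'i)^-1 * ('i * weight_form p 'X^n).
  by rewrite [in RHS]invfM mulrA mulfVK ?i_neq0.
rewrite -mulrDr; congr (_ * _); apply/eqP; rewrite eq_sym -subr_eq0 -mulNr; apply/eqP.
apply: H => [t|].
  rewrite /q !horner_ringE cisN exprS expr1; field.
  by rewrite nz cis_neq0.
by rewrite cisN cis2pi invr1 oppr0 cis0 /weight (_ : cos (2 * pi) = cos 0)// cos0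
  mulr_natl cos2pi.
Qed.

End WeightForm.

(** * Matrices and the orthogonal polynomials of the weight *)

Section MatrixDerivative.
Variable R : realType.
Local Notation C := R[i].

Lemma cvg_mx (T : Type) (F : set_system T) m n (M : T -> 'M[C]_(m, n))
    (D : 'M[C]_(m, n)) : Filter F ->
  (forall i j, M x i j @[x --> F] --> D i j) -> M @ F --> D.
Proof.
move=> FF H A [P nP sPA].
apply: (@filterS _ F _ [set x | forall i j, P i j (M x i j)]).
  by move=> x Px; exact: sPA.
by apply: filter_forall => i; apply: filter_forall => j; apply: H; exact: nP.
Qed.

Lemma is_derive_mx m n (M : C -> 'M[C]_(m, n)) (D : 'M[C]_(m, n)) (z : C) :
  (forall i j, is_derive z (1:C) (fun w => M w i j) (D i j)) ->
  derivable M z 1 /\ derive1 M z = D.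
Proof.
move=> dM.
have H : (fun h : C => h^-1 *: (M (h + z) - M z)) @ 0^' --> D.
  apply: cvg_mx => i j; have := is_derive_quotient_cvg (dM i j).
  apply: cvg_trans; apply: near_eq_cvg; apply: nearW => h.
  by rewrite !mxE.
split; last exact: cvg_lim H.
apply/cvg_ex; exists D.
apply: cvg_trans H; apply: near_eq_cvg; apply: nearW => h /=.
by rewrite [h *: 1]mulr1.
Qed.

Lemma mulmx2 (a b c d a' b' c' d' : C) : mx2 a b c d *m mx2 a' b' c' d' =
  mx2 (a * a' + b * c') (a * b' + b * d') (c * a' + d * c') (c * b' + d * d').
Proof.
apply/matrixP => i j; rewrite !mxE big_ord_recl big_ord1 !mxE /=.
by case: i => [[|[|//]] ?]; case: j => [[|[|//]] ?].
Qed.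

Lemma scalemx2 (x a b c d : C) :
  x *: mx2 a b c d = mx2 (x * a) (x * b) (x * c) (x * d).
Proof.
by apply/matrixP => i j; rewrite !mxE; case: i => [[|[|//]] ?]; case: j => [[|[|//]] ?].
Qed.

Lemma mx2_unit (a b c d : C) : a * d - b * c != 0 -> mx2 a b c d \in unitmx.
Proof.
move=> D0; suff /mulmx1_unit[] : mx2 a b c d *m ((a * d - b * c)^-1 *: mx2 d (- b) (- c) a) = 1%:M by [].
rewrite -scalemxAr mulmx2 scalemx2; apply/matrixP => i j; rewrite !mxE.
by case: i => [[|[|//]] ?]; case: j => [[|[|//]] ?] /=; rewrite ?mulr1n ?mulr0n; field.
Qed.

Lemma is_derive_mx2 (a b c d : C -> C) (a' b' c' d' z : C) :
  is_derive z (1:C) a a' -> is_derive z (1:C) b b' ->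
  is_derive z (1:C) c c' -> is_derive z (1:C) d d' ->
  derivable (fun w => mx2 (a w) (b w) (c w) (d w)) z 1 /\
  derive1 (fun w => mx2 (a w) (b w) (c w) (d w)) z = mx2 a' b' c' d'.
Proof.
move=> da db dc dd; apply: is_derive_mx => i j; rewrite mxE.
under eq_fun do rewrite mxE.
by case: i => [[|[|//]] ?]; case: j => [[|[|//]] ?].
Qed.

End MatrixDerivative.

Lemma realC_eq0 (R : realType) (x : R) : (x%:C == 0) = (x == 0).
Proof. by rewrite eq_complex /= eqxx andbT. Qed.

(** * Reality of the polynomials and translation into the abstract setting *)

Section Orthogonality.
Variables (R : realType) (l : R) (Phi : nat -> {poly R[i]}) (kappa : nat -> R).
Hypothesis l_gt0 : 0 < l.
Hypothesis opuc : is_monic_OPUC (exp_weight l) Phi kappa.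
Local Notation C := R[i].
Local Notation a := (l%:C / 2 : C).
Local Notation B := (weight_form l).
Local Notation h := (fun n => (kappa n ^- 2)%:C : C).

Lemma opuc_monic n : Phi n \is monic.
Proof. by have [/(_ n)[]] := opuc. Qed.

Lemma opuc_size n : size (Phi n) = n.+1.
Proof. by have [/(_ n)[]] := opuc. Qed.

Lemma opuc_kappa n : 0 < kappa n.
Proof. by have [_ /(_ n)] := opuc. Qed.

Lemma opuc_norm_neq0 n : h n != 0.
Proof.
by rewrite realC_eq0 invr_eq0 expf_eq0 gt_eqF ?opuc_kappa.
Qed.

Lemma weight_form_conj_orth n m :
  B (Phi n) (map_poly conjc (Phi m)) = h n *+ (n == m).
Proof. by rewrite -mu_integral_weight_form; have [_ _] := opuc; apply. Qed.

Lemma weight_form_orth n (q : {poly C}) :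
  (size q <= n.+1)%N -> B (Phi n) q = q`_n * h n.
Proof.
(* Only the bound on [q] becomes a variable [k <= n.+1]; induction on it strips the leading term of
   [q] with the conjugate of [Phi k]. *)
move: (leqnn n.+1); move: {1 3}n.+1 => k.
elim: k q => [|k IHk] q kn sq.
  move: sq; rewrite leqn0 size_poly_eq0 => /eqP ->.
  by rewrite coef0 mul0r (bform0r (@weight_form_linr R l)).
pose Q := map_poly conjc (Phi k).
have sQ : size Q = k.+1 by rewrite size_map_poly opuc_size.
have Qk : Q`_k = 1.
  by rewrite coef_map /= (Phi_lead opuc_monic opuc_size) conjc1.
have Qn : Q`_n = (n == k)%:R.
  move: kn; rewrite leq_eqVlt => /predU1P[[<-]|kn]; first by rewrite Qk eqxx.
  by rewrite nth_default ?sQ// gtn_eqF.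
pose r := q - (q`_k)%:P * Q.
have qE : q = (q`_k)%:P * Q + r by rewrite /r; ring.
have qn : q`_n = q`_k * Q`_n + r`_n by rewrite {1}qE coefD coefCM.
have sr : (size r <= k)%N.
  apply/leq_sizeP => j; rewrite leq_eqVlt => /predU1P[<-|kj].
    by rewrite coefB coefCM Qk mulr1 subrr.
  rewrite coefB coefCM (nth_default _ (leq_trans sq kj)).
  by rewrite [Q`_j]nth_default ?sQ// mulr0 subrr.
rewrite {1}qE weight_form_linr weight_form_conj_orth (IHk _ (ltnW kn) sr).
rewrite qn Qn -mulr_natl; ring.
Qed.

Lemma weight_form_sym p q : B p q = B q p.
Proof.
apply: (@bform_sym _ a) => //.
- exact: weight_form_linl.
- exact: weight_form_linr.
- exact: weight_form_shift.
- by rewrite mulf_neq0 ?invr_eq0 ?pnatr_eq0// realC_eq0 gt_eqF.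
- exact: weight_form_pearson.
Qed.

(** By symmetry, pairing the conjugate of [Phi n] with [q] gives the complex conjugate of pairing
    [Phi n] with the conjugate of [q], which is zero in lower degree. Uniqueness concludes. *)
Lemma opuc_real n : map_poly conjc (Phi n) = Phi n.
Proof.
apply: (Phi_unique (@weight_form_linl R l) weight_form_sym opuc_monic
  opuc_size opuc_norm_neq0 weight_form_orth).
- rewrite monicE lead_coef_map; have := opuc_monic n; rewrite monicE => /eqP ->.
  by rewrite rmorph1.
- by rewrite size_map_poly opuc_size.
- move=> q sq; rewrite weight_form_sym -(map_poly_conjK q) -weight_form_conj.
  rewrite weight_form_orth ?size_map_poly ?(leq_trans sq)//.
  by rewrite nth_default ?size_map_poly// mul0r conjc0.
Qed.

Lemma opuc_coef_real n i : conjc (Phi n)`_i = (Phi n)`_i.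
Proof. by rewrite -[in RHS]opuc_real coef_map. Qed.

Lemma verblunsky_al k : verblunsky Phi (k%:Z - 1) = al Phi k.
Proof.
case: k => [|k]; first by rewrite (al0 opuc_monic opuc_size).
have -> : k.+1%:Z - 1 = k by lia.
by rewrite /verblunsky horner_coef0 /al -[in RHS]opuc_coef_real.
Qed.

Lemma verblunsky_alS k : verblunsky Phi k%:Z = al Phi k.+1.
Proof. by rewrite -verblunsky_al; congr verblunsky; lia. Qed.

Lemma al_real k : complex.Im (al Phi k) = 0.
Proof.
rewrite /al; have := opuc_coef_real k 0; case: (Phi k)`_0 => x y [] /eqP.
by rewrite eq_sym -addr_eq0 -mulr2n mulrn_eq0 /= => /eqP ->; rewrite oppr0.
Qed.

Lemma reversedE n (z : C) : z != 0 -> reversed Phi n z = (Psi Phi n).[z].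
Proof.
move=> z0; rewrite /reversed -[Num.conj _]/(conjc _) conj_horner opuc_real.
have -> : conjc (z^*)^-1 = z^-1 by rewrite rmorphV ?unitfE ?conjc_eq0//= conjcK.
rewrite (@horner_coef_wide _ n.+1) ?opuc_size// horner_poly mulr_sumr.
rewrite (reindex_inj rev_ord_inj) /=; apply: eq_bigr => i _.
rewrite subSS mulrCA; congr (_ * _).
have {1}-> : n = (i + (n - i))%N by have := leq_ord i; lia.
by rewrite exprD exprVn -mulrA divff ?expf_neq0// mulr1.
Qed.

Lemma GfunE n z : Gfun (exp_weight l) Phi n z = cauchy_transform l z n (Phi n).
Proof.
rewrite /Gfun circle_integralE; congr (_ * _); apply: eq_cint => t.
rewrite exp_weight_cis cisN exprVn; ring.
Qed.

Lemma GstarE n z : Gstar (exp_weight l) Phi n z = cauchy_transform l z n.+1 (Psi Phi n).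
Proof.
rewrite /Gstar circle_integralE; congr (_ * _); apply: eq_cint => t.
rewrite reversedE ?cis_neq0// exp_weight_cis cisN exprVn; ring.
Qed.

Lemma two_piV_neq0 : (2 * pi%:C)^-1 != 0 :> C.
Proof. by rewrite invr_eq0 mulf_neq0 ?pnatr_eq0// realC_eq0 gt_eqF ?pi_gt0. Qed.

(** The inverted quantity is the constant w h_n of [cauchy_det], so that det Y_n = 1. *)
Lemma bcoefE n : bcoef kappa n = ((2 * pi%:C)^-1 * h n)^-1 :> C.
Proof.
rewrite /bcoef invfM invrK -fmorphV /= invrK !(rmorphM, rmorphXn) /=.
by rewrite (rmorph_nat _ 2).
Qed.

Lemma bcoef_ratio n : bcoef kappa n * (bcoef kappa n.+1)^-1 = 1 - al Phi n.+1 ^+ 2 :> C.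
Proof.
rewrite !bcoefE invrK (norm_succ (@weight_form_linl R l) (@weight_form_linr R l)
  (@weight_form_shift R l) weight_form_sym opuc_monic opuc_size opuc_norm_neq0
  weight_form_orth).
by rewrite (mulrCA _ (1 - _)) mulrC mulfK// mulf_neq0 ?opuc_norm_neq0// two_piV_neq0.
Qed.

End Orthogonality.

(** * The differential equation for the Riemann-Hilbert matrix *)

Section RiemannHilbertMatrix.
Variables (R : realType) (l : R) (Phi : nat -> {poly R[i]}) (kappa : nat -> R).
Hypothesis l_gt0 : 0 < l.
Hypothesis opuc : is_monic_OPUC (exp_weight l) Phi kappa.
Local Notation C := R[i].
Local Notation a := (l%:C / 2 : C).
Local Notation b := (bcoef kappa).
Local Notation al := (al Phi).
Local Notation Psi := (Psi Phi).
Local Notation T z n := (cauchy_transform l z n).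

Variables (m : nat) (z : C).
Hypothesis z_neq0 : z != 0.
Hypothesis z_circle : `|z| != 1.

Let linl := @weight_form_linl R l.
Let linr := @weight_form_linr R l.
Let shift := @weight_form_shift R l.
Let sym := weight_form_sym l_gt0.
Let monic := opuc_monic opuc.
Let sizeP := opuc_size opuc.
Let norm0 := opuc_norm_neq0 opuc.
Let orth := weight_form_orth opuc.
Let pearson := @weight_form_pearson R l.

Lemma Y_det : (Phi m.+1).[z] * (- b m * T z m.+1 (Psi m))
  - T z m.+1 (Phi m.+1) * (- b m * (Psi m).[z]) = 1.
Proof.
have E := cauchy_det linl linr shift sym monic sizeP norm0 orth
  (fun n c p q => cauchy_lin l n c p q z_circle)
  (fun n p => cauchy_subX l n p z_circle) (cauchyXS l z) m.
have -> : (Phi m.+1).[z] * (- b m * T z m.+1 (Psi m))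
  - T z m.+1 (Phi m.+1) * (- b m * (Psi m).[z]) =
  b m * (T z m.+1 (Phi m.+1) * (Psi m).[z] - (Phi m.+1).[z] * T z m.+1 (Psi m)) by ring.
rewrite E bcoefE mulVf//.
by apply: mulf_neq0; [exact: two_piV_neq0|exact: norm0].
Qed.

Lemma Y11_ode : z ^+ 2 * (Phi m.+1)^`().[z] =
  (m.+1%:R * z + a * (1 - al m.+1 ^+ 2)) * (Phi m.+1).[z]
  + a * (1 - al m.+1 ^+ 2) * (al m.+1 - al m.+2 * z) * (Psi m).[z].
Proof.
have := congr1 (horner^~ z)
  (Phi_ode linl linr shift sym monic sizeP norm0 orth pearson m).
by rewrite !horner_ringE.
Qed.

Lemma Y21_ode : z ^+ 2 * (Psi m)^`().[z] =
  a * ((al m.+1 - al m * z) * (Phi m.+1).[z]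
       + (al m.+1 ^+ 2 - z ^+ 2) * (Psi m).[z]).
Proof.
have := congr1 (horner^~ z)
  (Psi_ode linl linr shift sym monic sizeP norm0 orth pearson m).
by rewrite !horner_ringE => ->; ring.
Qed.

Lemma Y12_ode : z ^+ 2 * cauchy_transform' l z m.+1 (Phi m.+1) =
  (a * (1 - al m.+1 ^+ 2) - a + a * z ^+ 2) * T z m.+1 (Phi m.+1)
  + a * (1 - al m.+1 ^+ 2) * (al m.+1 - al m.+2 * z) * T z m.+1 (Psi m).
Proof.
rewrite cauchy_transform'E//.
exact: (cauchy_Phi_ode linl linr shift sym monic sizeP norm0 orth pearson
  (fun n c p q => cauchy_lin l n c p q z_circle)
  (fun n p => cauchy_subX l n p z_circle)).
Qed.

Lemma Y22_ode : z ^+ 2 * cauchy_transform' l z m.+1 (Psi m) =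
  a * (al m.+1 - al m * z) * T z m.+1 (Phi m.+1)
  - (a * (1 - al m.+1 ^+ 2) + m.+1%:R * z) * T z m.+1 (Psi m).
Proof.
rewrite cauchy_transform'E//.
exact: (cauchy_Psi_ode linl linr shift sym monic sizeP norm0 orth pearson
  (fun n c p q => cauchy_lin l n c p q z_circle)
  (fun n p => cauchy_subX l n p z_circle)).
Qed.

Variables (r s : C -> C).
Hypothesis r_branch : sqrt_branch_near id z r.
Hypothesis s_branch : sqrt_branch_near (exp_weight l) z s.

Lemma r_sqr : r z ^+ 2 = z.
Proof. by case: (nbhs_singleton r_branch). Qed.

Lemma s_sqr : s z ^+ 2 = exp_weight l z.
Proof. by case: (nbhs_singleton s_branch). Qed.

Lemma r_neq0 : r z != 0.
Proof. by rewrite -sqrf_eq0 r_sqr. Qed.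

Lemma s_neq0 : s z != 0.
Proof. by rewrite -sqrf_eq0 s_sqr cexp_neq0. Qed.

Lemma is_derive_r : is_derive z (1:C) r ((2 * r z)^-1).
Proof.
have := is_derive_sqrt_branch z_neq0 r_branch (is_derive_id z (1:C)).
by rewrite mul1r.
Qed.

Lemma is_derive_s : is_derive z (1:C) s (a / 2 * (1 - z ^- 2) * s z).
Proof.
have nu0 : exp_weight l z != 0 by exact: cexp_neq0.
have := is_derive_sqrt_branch nu0 s_branch (is_derive_exp_weight l z_neq0).
rewrite -s_sqr; congr (is_derive _ _ _ _).
by rewrite expr2; field; rewrite z_neq0 s_neq0.
Qed.

(* [C_n' C_n^-1 = logder * diag (1, -1)]. *)
Let logder := - (m.+1%:R / (2 * z)) + a / 2 * (1 - z ^- 2).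

Lemma is_derive_C11 : is_derive z (1:C) (fun w => r w ^- m.+1 * s w)
  (logder * (r z ^- m.+1 * s z)).
Proof.
have rX0 : r z ^+ m.+1 != 0 by rewrite expf_neq0// r_neq0.
have := is_deriveM_C (is_deriveV_C (f := fun w => r w ^+ m.+1) rX0
  (is_deriveX_C m.+1 is_derive_r)) is_derive_s.
congr (is_derive _ _ _ _).
rewrite /logder !(exprS _ m) /=; have := r_sqr; have := r_neq0.
(* Substituting rho^2 for [z] leaves a rational identity in rho, without square roots. *)
move: (r z) (s z) => rho sg rho0 <-.
have := expf_neq0 m rho0; set e := rho ^+ m => e0.
by field; rewrite rho0 e0.
Qed.

Lemma is_derive_C22 : is_derive z (1:C) (fun w => r w ^+ m.+1 * (s w)^-1)
  (- logder * (r z ^+ m.+1 * (s z)^-1)).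
Proof.
have := is_deriveM_C (is_deriveX_C m.+1 is_derive_r) (is_deriveV_C s_neq0 is_derive_s).
congr (is_derive _ _ _ _).
rewrite /logder !(exprS _ m) /=; have := r_sqr; have := r_neq0; have := s_neq0.
move: (r z) (s z) => rho sg sg0 rho0 <-.
have := expf_neq0 m rho0; set e := rho ^+ m => e0.
by field; rewrite rho0 sg0.
Qed.

Lemma ZmxE : Zmx (exp_weight l) Phi kappa r s m.+1 = (fun w => mx2
  ((Phi m.+1).[w] * (r w ^- m.+1 * s w))
  (T w m.+1 (Phi m.+1) * (r w ^+ m.+1 * (s w)^-1))
  (- b m * reversed Phi m w * (r w ^- m.+1 * s w))
  (- b m * T w m.+1 (Psi m) * (r w ^+ m.+1 * (s w)^-1))).
Proof.
apply/funext => w; rewrite /Zmx /Ymx /Cmx mulmx2 GfunE (GstarE l_gt0 opuc).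
by rewrite !mulr0 !addr0 !add0r.
Qed.

(** [reversed] agrees with a polynomial away from 0, hence on a neighbourhood of [z]. *)
Lemma is_derive_reversed :
  is_derive z (1:C) (fun w => reversed Phi m w) (Psi m)^`().[z].
Proof.
apply: near_eq_is_derive (is_derive_horner_C (Psi m) z).
have w_neq0 : \forall w \near z, w != 0 by exact: (cvgr_neq0 _ cvg_id z_neq0).
near=> w; rewrite (reversedE l_gt0 opuc)//; by near: w.
Unshelve. all: by end_near. Qed.

Lemma Zmx_derive :
  derivable (Zmx (exp_weight l) Phi kappa r s m.+1) z 1 /\
  derive1 (Zmx (exp_weight l) Phi kappa r s m.+1) z = mx2
   ((Phi m.+1)^`().[z] * (r z ^- m.+1 * s z)
     + (Phi m.+1).[z] * (logder * (r z ^- m.+1 * s z)))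
   (cauchy_transform' l z m.+1 (Phi m.+1) * (r z ^+ m.+1 * (s z)^-1)
     + T z m.+1 (Phi m.+1) * (- logder * (r z ^+ m.+1 * (s z)^-1)))
   (- b m * (Psi m)^`().[z] * (r z ^- m.+1 * s z)
     + - b m * (Psi m).[z] * (logder * (r z ^- m.+1 * s z)))
   (- b m * cauchy_transform' l z m.+1 (Psi m) * (r z ^+ m.+1 * (s z)^-1)
     + - b m * T z m.+1 (Psi m) * (- logder * (r z ^+ m.+1 * (s z)^-1))).
Proof.
have cst_mul (f : C -> C) f' : is_derive z (1:C) f f' ->
    is_derive z (1:C) (fun w => - b m * f w) (- b m * f').
  move=> df; have := is_deriveM_C (is_derive_cst (- b m) z (1:C)) df.
  by rewrite mul0r add0r.
rewrite ZmxE; apply: is_derive_mx2.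
- exact: is_deriveM_C (is_derive_horner_C _ _) is_derive_C11.
- exact: is_deriveM_C (is_derive_cauchy_transform _ _ _ z_circle) is_derive_C22.
- have := is_deriveM_C (cst_mul _ _ is_derive_reversed) is_derive_C11.
  by rewrite (reversedE l_gt0 opuc _ z_neq0).
- exact: is_deriveM_C (cst_mul _ _ (is_derive_cauchy_transform _ _ _ z_circle)) is_derive_C22.
Qed.

Lemma Zmx_unit : Zmx (exp_weight l) Phi kappa r s m.+1 z \in unitmx.
Proof.
rewrite ZmxE; apply: mx2_unit; rewrite (reversedE l_gt0 opuc _ z_neq0).
(* det C_n = 1, so det Z_n = det Y_n = 1. *)
have uv : (r z ^- m.+1 * s z) * (r z ^+ m.+1 * (s z)^-1) = 1.
  by rewrite mulrACA mulVf ?expf_neq0 ?r_neq0// mul1r divff// s_neq0.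
set X := _ - _.
suff -> : X = 1 by exact: oner_neq0.
rewrite -[RHS]mulr1 -[X in _ = X * _]Y_det -uv /X; ring.
Qed.

Lemma Mmx_eq : z ^+ 2 *: Mmx (exp_weight l) Phi kappa r s m.+1 z =
  let d := l%:C / 4 * z ^+ 2 + m.+1%:R / 2 * z
    + l%:C / 4 * (b m * (b m.+1)^-1 - al m.+1 ^+ 2) in
  mx2 d
    (- (l%:C / 2) * (b m.+1)^-1 * (al m.+1 - al m.+2 * z))
    (- (l%:C / 2) * b m * (al m.+1 - al m * z))
    (- d).
Proof.
cbv zeta; set d := _ + l%:C / 4 * (_ - _).
rewrite /Mmx Zmx_derive.2 scalemxAl.
set A := mx2 d _ _ _; set Z := Zmx _ _ _ _ _ _ z.
(* It remains to prove z^2 Z' = A Z, which involves no inverse matrix. *)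
transitivity (A *m Z *m invmx Z); last by rewrite mulmxK// Zmx_unit.
congr (_ *m _); rewrite /A /Z ZmxE (reversedE l_gt0 opuc _ z_neq0) scalemx2 mulmx2.
have z2 : z ^+ 2 * logder = - (m.+1%:R / 2 * z) + l%:C / 4 * (z ^+ 2 - 1).
  by rewrite /logder; field.
have dE : d = l%:C / 4 * z ^+ 2 + m.+1%:R / 2 * z
    + l%:C / 4 * (1 - al m.+1 ^+ 2 - al m.+1 ^+ 2).
  by rewrite -(bcoef_ratio l_gt0 opuc m).
have bV : (b m.+1)^-1 * b m = 1 - al m.+1 ^+ 2.
  by rewrite mulrC (bcoef_ratio l_gt0 opuc m).
(* Each column carries a common factor, [u] or [v], on both sides; what remains is one scalar
   equation per entry. *)
move: (r z ^- m.+1 * s z) (r z ^+ m.+1 * (s z)^-1) => u v.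
have split2 x y c w : z ^+ 2 * (x * w + y * (c * w))
    = (z ^+ 2 * x + (z ^+ 2 * c) * y) * w :> C by ring.
have split1 x y c w : z ^+ 2 * (- b m * x * w + - b m * y * (c * w))
    = - b m * (z ^+ 2 * x + (z ^+ 2 * c) * y) * w :> C by ring.
have off12 c y w : - a * (b m.+1)^-1 * c * (- b m * y * w)
    = a * (1 - al m.+1 ^+ 2) * c * y * w :> C by rewrite -bV; ring.
rewrite !split1 !split2 !off12 Y11_ode Y12_ode Y21_ode Y22_ode mulrN z2 dE.
by congr (mx2 _ _ _ _); field.
Qed.

End RiemannHilbertMatrix.

Theorem mainTheorem7 (R : realType) (l : R) (Phi : nat -> {poly R[i]})
    (kappa : nat -> R) :
  0 < l ->
  is_monic_OPUC (exp_weight l) Phi kappa ->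
  let alpha := verblunsky Phi in
  let b := bcoef kappa in
  (forall k : int, -1 <= k -> complex.Im (alpha k) = 0) /\
  (forall n : nat, (0 < n)%N ->
   forall (z : R[i]) (r s : R[i] -> R[i]),
     z != 0 -> `|z| != 1 ->
     sqrt_branch_near id z r ->
     sqrt_branch_near (exp_weight l) z s ->
     [/\ derivable (Zmx (exp_weight l) Phi kappa r s n) z 1,
         Zmx (exp_weight l) Phi kappa r s n z \in unitmx &
         z ^+ 2 *: Mmx (exp_weight l) Phi kappa r s n z =
         let d := l%:C / 4 * z ^+ 2 + n%:R / 2 * z
                  + l%:C / 4 * (b n.-1 * (b n)^-1 - alpha (n%:Z - 1) ^+ 2) in
         mx2 d
             (- (l%:C / 2) * (b n)^-1 * (alpha (n%:Z - 1) - alpha n%:Z * z))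
             (- (l%:C / 2) * b n.-1 * (alpha (n%:Z - 1) - alpha (n%:Z - 2) * z))
             (- d)]).
Proof.
move=> l0 opuc alpha b; split=> [[k|k] _|[//|m] _ z r s z0 z1 br bs].
- by rewrite /alpha (verblunsky_alS l0 opuc) (al_real l0 opuc).
- by rewrite /= oppr0.
(* [derive1] and [invmx] are total; the first two claims ensure that M_n is not built from default
   values. *)
split.
- by have [] := Zmx_derive l0 opuc m z0 z1 br bs.
- exact: (Zmx_unit l0 opuc m z0 z1 br bs).
rewrite (Mmx_eq l0 opuc m z0 z1 br bs) /alpha.
have -> : m.+1%:Z - 2 = m%:Z - 1 by lia.
by rewrite !(verblunsky_al l0 opuc) !(verblunsky_alS l0 opuc).
Qed.
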